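(* Let $N\ge1$. For any radii $0<r_{N+1}<r_N<\dots<r_2<r_1$ and any fixed $\eta_{N+1}\in[-1,1]$, there exists a nontrivial (i.e. nonzero) combination $\eta'=(\eta_1,\dots,\eta_N)$ with $\eta_n\in[-1,1]$, $n=1,\dots,N$, such that the $N$-GPTs of the two-dimensional concentric disk structure vanish, i.e. $\mathcal{M}_N(\eta',\eta_{N+1})=0$.
   Context: Dimension $d=2$. Let $\Gamma_k=\{x\in\mathbb{R}^2:|x|=r_k\}$ with outward unit normal $\nu_k$, $k=1,\dots,N+1$. The regions $\Omega_0=\{|x|>r_1\}$, $\Omega_k=\{r_{k+1}<|x|\le r_k\}$ ($1\le k\le N$), $\Omega_{N+1}=\{|x|\le r_{N+1}\}$ have constant conductivities $\sigma_k$, with $\sigma_0=1$, and contrasts $\eta_k=\frac{\sigma_k-\sigma_{k-1}}{\sigma_k+\sigma_{k-1}}$, $k=1,\dots,N+1$. Let $G(x)=\frac{1}{2\pi}\ln|x|$, $\mathcal{S}_{\Gamma}[\phi](x)=\int_\Gamma G(x-y)\phi(y)\,d\sigma_y$, $\mathcal{K}^*_\Gamma[\phi](x)=\int_\Gamma \frac{\partial G(x-y)}{\partial\nu_x}\phi(y)\,d\sigma_y$ for $x\in\Gamma$, and $L_0^2(\Gamma)=\{\phi\in L^2(\Gamma):\int_\Gamma\phi=0\}$. For $\eta\in[-1,1]^{N+1}$ and $n\ge1$, let $(\phi_1,\dots,\phi_{N+1})\in\prod_k L^2_0(\Gamma_k)$ be the solution of $$\phi_j-2\eta_j\mathcal{K}^*_{\Gamma_j}[\phi_j]-2\eta_j\sum_{k\ne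 j}\partial_{\nu_j}\mathcal{S}_{\Gamma_k}[\phi_k]=2\eta_j\,\partial_{\nu_j}H\quad\text{on }\Gamma_j,\qquad j=1,\dots,N+1,$$ with $H(x)=r^n\cos n\theta$ in polar coordinates. Set $M_n[\eta]=\sum_{k=1}^{N+1}\int_{\Gamma_k} r^n\cos(n\theta)\,\phi_k\,d\sigma$ and $\mathcal{M}_N(\eta)=(M_1[\eta],\dots,M_N[\eta])$.
   Formalization: The combination η' is claimed to be nonzero only when η_{N+1} ≠ 0; for η_{N+1} = 0 the claim as stated fails (for N = 1, M_1 = 2πη_1 r_1² vanishes only for η_1 = 0). *)

(* Defs.v *)
From mathcomp Require Import all_boot all_order all_algebra.
From mathcomp Require Import all_classical all_reals all_analysis.
Set Implicit Arguments.
Unset Strict Implicit.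
Unset Printing Implicit Defensive.
Import Order.TTheory GRing.Theory Num.Theory.
Import numFieldNormedType.Exports.
Local Open Scope classical_set_scope.
Local Open Scope ring_scope.

Notation plane R := (R^o * R^o)%type.

(* The library norm on a product is the sup norm, hence [enorm]. *)
Definition enorm (R : realType) (x : plane R) : R :=
  Num.sqrt (x.1 ^+ 2 + x.2 ^+ 2).

Definition polar_angle (R : realType) (x : plane R) : R :=
  if 0 <= x.2 then acos (x.1 / enorm x) else - acos (x.1 / enorm x).

Definition harmonic (R : realType) (n : nat) (x : plane R) : R :=
  enorm x ^+ n * cos (n%:R * polar_angle x).

(* Functions on the circle of radius rho centred at the origin are represented
   by functions on the plane, of which only the values at the points
   [circ rho t] matter. *)
Definition circ (R : realType) (rho t : R) : plane R :=
  (rho * cos t, rho * sin t).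

Definition period (R : realType) : set R := `[0, 2 * pi]%classic.
Arguments period : clear implicits.

Definition circle_int (R : realType) (rho : R) (f : plane R -> R) : R :=
  \int[lebesgue_measure]_(t in period R) (f (circ rho t) * rho).

Definition ae_circle (R : realType) (rho : R) (P : plane R -> Prop) : Prop :=
  {ae lebesgue_measure, forall t : R, period R t -> P (circ rho t)}.

Definition L2_circle (R : realType) (rho : R) (f : plane R -> R) : Prop :=
  measurable_fun (period R) (fun t : R => f (circ rho t)) /\
  lebesgue_measure.-integrable (period R)
    (fun t : R => (f (circ rho t) ^+ 2 * rho)%:E).

Definition L20_circle (R : realType) (rho : R) (f : plane R -> R) : Prop :=
  L2_circle rho f /\ circle_int rho f = 0.

Definition normal (R : realType) (x : plane R) : plane R :=
  (x.1 / enorm x, x.2 / enorm x).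

Definition normal_derive (R : realType) (f : plane R -> R) (x : plane R) : R :=
  'D_(normal x) (f : plane R -> R^o) x.

Definition G (R : realType) (x : plane R) : R := (2 * pi)^-1 * ln (enorm x).

Definition single_layer (R : realType) (rho : R) (phi : plane R -> R)
    (x : plane R) : R :=
  circle_int rho (fun y => G (x - y) * phi y).

Definition NP_adjoint (R : realType) (rho : R) (phi : plane R -> R)
    (x : plane R) : R :=
  circle_int rho (fun y => normal_derive (fun z => G (z - y)) x * phi y).

(* The circles are indexed from 0: [r ord0] is the outermost radius and
   [r ord_max] the innermost one. *)
Definition density_solution (R : realType) (N : nat) (r eta : 'I_N.+1 -> R)
    (H : plane R -> R) (phi : 'I_N.+1 -> plane R -> R) : Prop :=
  (forall j, L20_circle (r j) (phi j)) /\
  (forall j, ae_circle (r j) (fun x =>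
     phi j x - 2 * eta j * NP_adjoint (r j) (phi j) x
     - 2 * eta j *
         \sum_(k < N.+1 | k != j) normal_derive (single_layer (r k) (phi k)) x
     = 2 * eta j * normal_derive H x)).

(* "phi is the solution": elements of L^2 are identified when they agree almost
   everywhere. *)
Definition the_density_solution (R : realType) (N : nat)
    (r eta : 'I_N.+1 -> R) (H : plane R -> R)
    (phi : 'I_N.+1 -> plane R -> R) : Prop :=
  density_solution r eta H phi /\
  (forall psi, density_solution r eta H psi ->
     forall j, ae_circle (r j) (fun x => psi j x = phi j x)).

(* [is_GPT r eta n m]: the system with H = r^n cos(n theta) is uniquely
   solvable, and the resulting M_n[eta] is m. *)
Definition is_GPT (R : realType) (N : nat) (r eta : 'I_N.+1 -> R) (n : nat)
    (m : R) : Prop :=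
  exists phi : 'I_N.+1 -> plane R -> R,
    the_density_solution r eta (harmonic n) phi /\
    m = \sum_(k < N.+1) circle_int (r k) (fun x => harmonic n x * phi k x).

Definition is_GPT_vector (R : realType) (N : nat) (r eta : 'I_N.+1 -> R)
    (v : 'rV[R]_N) : Prop :=
  forall i : 'I_N, is_GPT r eta i.+1 (v 0 i).

(* The tuple (eta', e), with e at the innermost index. *)
Definition append_contrast (R : realType) (N : nat) (eta' : 'rV[R]_N) (e : R)
    (k : 'I_N.+1) : R :=
  if unlift ord_max k is Some i then eta' 0 i else e.

(* Main.v *)
(* On the n-th Fourier mode a density solving the system is
   x_j r_j^(n-1) cos (n t) on circle j, and the system becomes
     x_j = eta_j (2n - sum_(k<j) x_k + sum_(k>j) (r_k / r_j)^(2n) x_k).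
   It has a unique solution and M_n = 2 pi n r_1^(2n) t_1, where t_1 is the outer
   reflection coefficient, computed inwards by
     t_j = (eta_j + rho_j) / (1 + eta_j rho_j),
     rho_j = (r_(j+1) / r_j)^(2n) t_(j+1).
   Uniqueness in L^2 needs no completeness of the Fourier basis: the system
   expresses a solution almost everywhere through Poisson kernels, i.e. as the
   sum of a geometrically convergent Fourier series.

   It remains to find a common zero eta' of the N functions t_1 (n = 1, ..., N)
   on the cube [-1,1]^N. They are odd when eta_(N+1) is negated too, and if
   |eta_j| = 1 then they do not depend on the layers beyond j; so they are odd on
   the boundary of the cube and Borsuk's theorem applies. It is derived from
   Tucker's lemma, proved by Ky Fan's argument: if no edge of the triangulated
   cube has complementary labels, then the number of simplices of the face
   [-1,1]^d * {1} whose labels alternate in sign is odd for every d < N, which is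
   impossible one dimension higher. *)
Require Import Defs.
From mathcomp Require Import all_boot all_order all_algebra.
From mathcomp Require Import all_classical all_reals all_analysis.
From mathcomp Require Import measurable_realfun ring lra.
Set Implicit Arguments.
Unset Strict Implicit.
Unset Printing Implicit Defensive.
Import Order.TTheory GRing.Theory Num.Theory.
Import numFieldNormedType.Exports.

(** * Tucker's lemma *)

(* A mod 2 chain of ordered simplices (lists of vertices) is represented by the
   functional summing a mod 2 cochain [g] over it: [face_sum] is the boundary of
   [s], and [prism_sum] the triangulation of the prism between [map a s] and
   [map b s] by the lists [a v_0, ..., a v_i, b v_i, ..., b v_k]. *)
Fixpoint face_sum (V : Type) (g : seq V -> bool) (s : seq V) : bool :=
  if s is v :: s' then g s' (+) face_sum (fun l => g (v :: l)) s' else false.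

Fixpoint prism_sum (V W : Type) (a b : V -> W) (g : seq W -> bool) (s : seq V) :
    bool :=
  if s is v :: s' then
    g (a v :: b v :: map b s') (+) prism_sum a b (fun l => g (a v :: l)) s'
  else false.

Lemma eq_prism_sum (V W : Type) (a b : V -> W) (g h : seq W -> bool) s :
  g =1 h -> prism_sum a b g s = prism_sum a b h s.
Proof.
elim: s g h => //= v s IH g h gh; rewrite gh; congr (_ (+) _).
by apply: IH => l; exact: gh.
Qed.

Lemma eq_prism_sum_fun (V W : Type) (a b a' b' : V -> W) g s :
  a =1 a' -> b =1 b' -> prism_sum a b g s = prism_sum a' b' g s.
Proof.
by move=> aa bb; elim: s g => //= v s IH g; rewrite IH aa bb (eq_map bb).
Qed.

Lemma face_sumD (V : Type) (g h : seq V -> bool) s :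
  face_sum (fun l => g l (+) h l) s = face_sum g s (+) face_sum h s.
Proof. by elim: s g h => //= v s IH g h; rewrite IH addbACA. Qed.

Lemma prism_sumD (V W : Type) (a b : V -> W) (g h : seq W -> bool) s :
  prism_sum a b (fun l => g l (+) h l) s =
  prism_sum a b g s (+) prism_sum a b h s.
Proof. by elim: s g h => //= v s IH g h; rewrite IH addbACA. Qed.

Lemma face_sum_map (V W : Type) (b : V -> W) (g : seq W -> bool) s :
  face_sum (fun l => g (map b l)) s = face_sum g (map b s).
Proof. by elim: s g => //= v s IH g; rewrite -IH. Qed.

(** Dual form of the chain homotopy formula: consecutive simplices of the prism share the wall
    [a v_0, ..., a v_(i-1), b v_i, ..., b v_k], which cancels mod 2; the two ends and the prism over
    the boundary remain. *)
Lemma prism_sum_face (V W : Type) (a b : V -> W) (g : seq W -> bool) s :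
  prism_sum a b (face_sum g) s =
  g (map b s) (+) g (map a s) (+) face_sum (prism_sum a b g) s.
Proof.
elim: s g => [|v s IH] g /=; first by rewrite addbb.
rewrite prism_sumD IH face_sumD.
rewrite (face_sum_map b (fun l => g (a v :: b v :: l))) /=.
move: (g _) (g _) (g _) (face_sum _ _) (face_sum _ _) (prism_sum _ _ _ _).
by do 6!case.
Qed.

Lemma prism_sum_rcons (V W : Type) (a b : V -> W) (g : seq W -> bool) s v :
  prism_sum a b g (rcons s v) =
  prism_sum a b (fun l => g (rcons l (b v))) s (+)
  g (rcons (rcons (map a s) (a v)) (b v)).
Proof.
by elim: s g => [|w s IH] g /=; rewrite ?addbF ?IH ?map_rcons ?addbA.
Qed.

(** Swapping the ends reverses the vertex order of the prism simplices; the central symmetry of the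
    triangulation rests on this. *)
Lemma prism_sum_rev (V W : Type) (a b : V -> W) (g : seq W -> bool) s :
  prism_sum b a (fun l => g (rev l)) s = prism_sum a b g (rev s).
Proof.
elim: s g => [|v s IH] g //=.
rewrite [in RHS]rev_cons prism_sum_rcons addbC !rev_cons -map_rev -IH.
by congr (_ (+) _); apply: eq_prism_sum => l; rewrite rev_cons.
Qed.

Lemma prism_sum_mapl (V W X : Type) (a b : V -> W) (d : W -> X)
    (g : seq X -> bool) s :
  prism_sum a b (fun l => g (map d l)) s = prism_sum (d \o a) (d \o b) g s.
Proof. by elim: s g => [|v s IH] g //=; rewrite -!map_comp -IH. Qed.

Lemma prism_sum_mapr (U V W : Type) (a b : V -> W) (c : U -> V)
    (g : seq W -> bool) s :
  prism_sum a b g (map c s) = prism_sum (a \o c) (b \o c) g s.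
Proof. by elim: s g => [|v s IH] g //=; rewrite -!map_comp -IH. Qed.

Lemma prism_sum_dup (V : eqType) (W : Type) (a b : V -> W) (g : seq W -> bool) s :
  (forall v, v \in s -> forall l1 l2, g (l1 ++ a v :: b v :: l2) = false) ->
  prism_sum a b g s = false.
Proof.
elim: s g => [|v s IH] g //= H; rewrite (H v (mem_head _ _) [::]).
apply: IH => w ws l1 l2; apply: (H w _ (a v :: l1) l2).
by rewrite inE ws orbT.
Qed.

Lemma prism_sum_supp (V W : eqType) (a b : V -> W) (g : seq W -> bool) s :
  (forall l, size l = (size s).+1 ->
     (forall x, x \in l -> exists2 v, v \in s & x = a v \/ x = b v) ->
     g l = false) ->
  prism_sum a b g s = false.
Proof.
elim: s g => [|v s IH] g //= H; rewrite H /= ?size_map //; last first.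
  move=> x; rewrite !inE => /or3P[/eqP->|/eqP->|/mapP[w ws ->]].
  - by exists v; rewrite ?mem_head //; left.
  - by exists v; rewrite ?mem_head //; right.
  - by exists w; rewrite ?inE ?ws ?orbT //; right.
apply: IH => l sl lP; apply: H => /=; first by rewrite sl.
move=> x; rewrite inE => /predU1P[->|/lP[w ws xw]].
  by exists v; rewrite ?mem_head //; left.
by exists w; rewrite ?inE ?ws ?orbT.
Qed.

(* The sum over the simplices of the Freudenthal triangulation of the
   grid cube [{0, ..., m}^d], each simplex being the list of its vertices. *)
Fixpoint cube_sum (m d : nat) (g : seq (seq nat) -> bool) : bool :=
  if d is d'.+1 then
    \big[addb/false]_(i < m)
      cube_sum m d' (prism_sum (rcons^~ (i : nat)) (rcons^~ i.+1) g)
  else g [:: [::]].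

(** The boundary by the same recursion: two end facets in the last direction, and slabs over the
    boundary of the cube below. A point has the empty simplex as boundary, hence [g [::]]. *)
Fixpoint bound_sum (m d : nat) (g : seq (seq nat) -> bool) : bool :=
  if d is d'.+1 then
    cube_sum m d' (fun s => g (map (rcons^~ m) s)) (+)
    cube_sum m d' (fun s => g (map (rcons^~ 0%N) s)) (+)
    \big[addb/false]_(i < m)
      bound_sum m d' (prism_sum (rcons^~ (i : nat)) (rcons^~ i.+1) g)
  else g [::].

Lemma eq_cube_sum m d g h : g =1 h -> cube_sum m d g = cube_sum m d h.
Proof.
elim: d g h => [|d IH] g h gh /=; first exact: gh.
by apply: eq_bigr => i _; apply: IH => s; exact: eq_prism_sum.
Qed.

Lemma cube_sumD m d g h :
  cube_sum m d (fun s => g s (+) h s) = cube_sum m d g (+) cube_sum m d h.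
Proof.
elim: d g h => [|d IH] g h //=; rewrite -big_split /=; apply: eq_bigr => i _.
by rewrite -IH; apply: eq_cube_sum => s; rewrite prism_sumD.
Qed.

Lemma addb_telescope (h : nat -> bool) n :
  \big[addb/false]_(i < n) (h i.+1 (+) h i) = h n (+) h 0%N.
Proof.
elim: n => [|n IH]; first by rewrite big_ord0 addbb.
rewrite big_ord_recr /= {}IH.
by move: (h n) (h n.+1) (h 0%N); do 3!case.
Qed.

Lemma cube_sum_face m d g : cube_sum m d (face_sum g) = bound_sum m d g.
Proof.
elim: d g => [|d IH] g /=; first by rewrite addbF.
under eq_bigr => i _.
  rewrite (eq_cube_sum _ _ (prism_sum_face _ _ _)).
  rewrite !cube_sumD IH; over.
(* The ends of consecutive slabs cancel mod 2, so only the outer facets survive. *)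
rewrite big_split /=; congr (_ (+) _).
exact: (addb_telescope (fun i => cube_sum m d (fun s => g (map (rcons^~ i) s)))).
Qed.

(** The condition on [g] collects the geometry of the simplices used below: [d + 1] grid points that
    differ pairwise by at most one in each coordinate. *)
Lemma cube_sum_supp m d g :
  (forall s, size s = d.+1 ->
     (forall v, v \in s -> size v = d /\ forall i, (nth 0 v i <= m)%N) ->
     (forall v w, v \in s -> w \in s ->
        forall i, (nth 0 v i <= (nth 0 w i).+1)%N) ->
     g s = false) ->
  cube_sum m d g = false.
Proof.
elim: d g => [|d IH] g H /=.
  apply: H => // [v|v w]; rewrite ?inE => /eqP->.
    by split => // i; rewrite nth_nil.
  by move=> /eqP-> i; rewrite nth_nil.
apply: big1 => i _; apply: IH => s ss sm s1; apply: prism_sum_supp => l sl lP.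
have im : (i < m)%N by [].
have {}lP x : x \in l -> exists v k, [/\ v \in s, x = rcons v k & i <= k <= i.+1].
  move=> /lP[v vs [->|->]].
    by exists v, (i : nat); split => //; rewrite leqnn leqnSn.
  by exists v, i.+1; split => //; rewrite leqnn leqnSn.
apply: H; first by rewrite sl ss.
  move=> x /lP[v [k [vs -> /andP[_ ki]]]]; have [sv vm] := sm _ vs.
  split; first by rewrite size_rcons sv.
  move=> j; rewrite nth_rcons; case: ifP => // _; case: ifP => // _.
  exact: leq_trans ki _.
move=> x y /lP[v [k [vs -> /andP[ik ki]]]] /lP[w [h [ws -> /andP[ih hi]]]] j.
have [[sv _] [sw _]] := (sm _ vs, sm _ ws).
rewrite !nth_rcons sv sw; case: ifP => // _; first exact: s1.
by case: ifP => // _; apply: leq_trans ki _.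
Qed.

Lemma eq_cube_sum_supp m d g h :
  (forall s, size s = d.+1 ->
     (forall v, v \in s -> size v = d /\ forall i, (nth 0 v i <= m)%N) ->
     (forall v w, v \in s -> w \in s ->
        forall i, (nth 0 v i <= (nth 0 w i).+1)%N) ->
     g s = h s) ->
  cube_sum m d g = cube_sum m d h.
Proof.
move=> gh; have: cube_sum m d (fun s => g s (+) h s) = false.
  by apply: cube_sum_supp => s ss sm s1; rewrite gh // addbb.
by rewrite cube_sumD; do 2!case: cube_sum.
Qed.

Lemma bound_sum_supp m d g :
  g [::] = false ->
  (forall s j c, (j < d)%N -> c = 0%N \/ c = m ->
     (forall v, v \in s -> size v = d /\ nth 0%N v j = c) -> g s = false) ->
  bound_sum m d g = false.
Proof.
elim: d g => [|d IH] g g0 H //=.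
have E c : c = 0%N \/ c = m -> cube_sum m d (fun s => g (map (rcons^~ c) s)) = false.
  move=> Hc; apply: cube_sum_supp => s ss sm _; apply: (H _ d c) => //.
  move=> x /mapP[v /sm[sv _] ->].
  by rewrite size_rcons nth_rcons sv ltnn eqxx.
rewrite !E; [|by left|by right].
apply: big1 => i _; apply: IH => // s j c jd Hc sP.
apply: prism_sum_supp => l _ lP; apply: (H _ j c) => //; first exact: ltnW.
by move=> x /lP[v /sP[sv vj] [->|->]]; rewrite size_rcons nth_rcons sv jd.
Qed.

Definition antipode (m : nat) : seq nat -> seq nat := map (subn m).

(** The central symmetry exchanges slab [i] with slab [m - 1 - i] and bottom with top, so it
    permutes the simplices while reversing their vertex order. *)
Lemma cube_sum_antipode m d g :
  cube_sum m d (fun s => g (rev (map (antipode m) s))) = cube_sum m d g.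
Proof.
elim: d g => [|d IH] g //=.
rewrite [RHS](reindex_inj rev_ord_inj) /=; apply: eq_bigr => i _.
rewrite -[RHS]IH; apply: eq_cube_sum => s.
rewrite -[RHS]prism_sum_rev prism_sum_mapr.
rewrite [LHS](prism_sum_mapl _ _ (antipode m) (fun l => g (rev l))).
by rewrite subnSK //; apply: eq_prism_sum_fun => v /=; rewrite /antipode map_rcons.
Qed.

(** * Label lists with alternating signs *)

Fixpoint alternating (b : bool) (w : bitseq) : bool :=
  if w is c :: w' then (c == b) && alternating (~~ b) w' else true.

(** If [w] alternates from [b], only deleting its last sign keeps this; if it alternates from
    [~~ b], only deleting its first sign helps. Otherwise the good deletions come in pairs, from two
    equal neighbours. *)
Lemma face_sum_alternating b w :
  face_sum (alternating b) w = alternating b w (+) alternating (~~ b) w.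
Proof.
have F0 V (l : seq V) : face_sum (fun=> false) l = false by elim: l.
by elim: w b => [|c w IH] [] //=; case: c; rewrite /= ?F0 ?IH //=;
  case: (alternating true w); case: (alternating false w).
Qed.

(* A nonzero integer, as its absolute value minus one and its positivity. *)
Definition label := (nat * bool)%type.

(** Breaking ties by sign makes the order antisymmetric, so that the sorted list depends on the
    multiset of labels alone. *)
Definition label_le (x y : label) :=
  (x.1 < y.1)%N || (x.1 == y.1) && (x.2 ==> y.2).

Definition label_opp (x : label) : label := (x.1, ~~ x.2).

(* The indicator of the label lists which, once ordered by absolute value, have
   alternating signs, the first one being [b]. *)
Definition fan (b : bool) (ls : seq label) : bool :=
  alternating b (map snd (sort label_le ls)).

Lemma label_le_total : total label_le.
Proof. by move=> [i [|]] [j [|]]; rewrite /label_le /=; case: ltngtP. Qed.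

Lemma label_le_trans : transitive label_le.
Proof.
move=> [j b] [i a] [k c]; rewrite /label_le /=.
case/orP=> [ij|/andP[/eqP-> ab]].
  case/orP=> [jk|/andP[/eqP<- _]]; first by rewrite (ltn_trans ij jk).
  by rewrite ij.
case/orP=> [->//|/andP[/eqP-> bc]]; rewrite eqxx ltnn /=.
by case: a b c ab bc => [] [] [].
Qed.

Lemma label_le_anti : antisymmetric label_le.
Proof.
move=> [i a] [j b]; rewrite /label_le /=.
by case: ltngtP => //= <-; case: a; case: b.
Qed.

Lemma perm_fan b ls ls' : perm_eq ls ls' -> fan b ls = fan b ls'.
Proof.
move=> /(perm_sortP label_le_total label_le_trans label_le_anti) E.
by rewrite /fan E.
Qed.

Lemma fan_sorted b ls : sorted label_le ls -> fan b ls = alternating b (map snd ls).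
Proof. by move=> S; rewrite /fan sorted_sort //; exact: label_le_trans. Qed.

Lemma fan_strict b ls : fan b ls ->
  sorted (fun x y => label_le x y && (x.2 != y.2)) (sort label_le ls).
Proof.
have := sort_sorted label_le_total ls; rewrite /fan.
case: (sort _ _) => //= x l; elim: l x b => //= y l IH x b /andP[xy yl].
move=> /and3P[/eqP xb yb Al]; rewrite xy xb (eqP yb) (IH _ (~~ b)) ?yb //=.
by case: (b).
Qed.

Lemma fan_uniq b ls : fan b ls -> uniq ls.
Proof.
move=> /fan_strict S; rewrite -(sort_uniq label_le).
have /(sorted_uniq _ _) :
    sorted (fun x y => label_le x y && (x != y)) (sort label_le ls).
  apply: sub_sorted S => x y /andP[-> xy] /=.
  by apply: contraNneq xy => ->.
apply.
- move=> y x z /andP[xy nxy] /andP[yz nyz]; rewrite (label_le_trans xy yz) /=.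
  apply: contraNneq nxy => xz; apply/eqP/label_le_anti.
  by rewrite xy xz yz.
- by move=> x; rewrite eqxx andbF.
Qed.

Definition consistent (ls : seq label) :=
  forall x y, x \in ls -> y \in ls -> x.1 = y.1 -> x = y.

Lemma fan_uniq_abs b ls : consistent ls -> fan b ls -> uniq (map fst ls).
Proof. by move=> C /fan_uniq U; rewrite map_inj_in_uniq // => x y xl yl; apply: C. Qed.

(** Pigeonhole: labels that alternate and are consistent have distinct absolute values, and there
    are only [N] of these. *)
Lemma fan_oversize N b ls : (forall x, x \in ls -> (x.1 < N)%N) -> consistent ls ->
  (N < size ls)%N -> fan b ls = false.
Proof.
move=> lN C sN; apply/negP => /(fan_uniq_abs C) U.
have := uniq_leq_size U (s2 := iota 0 N); rewrite size_map size_iota.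
rewrite leqNgt sN /= => H; suff : false by []; apply: H.
by move=> x /mapP[y yl ->]; rewrite mem_iota lN.
Qed.

(** Without complementary labels no tie has opposite signs, so negation keeps the sorted order and
    flips every sign. *)
Lemma fan_opp b ls : consistent ls ->
  fan b (map label_opp ls) = fan (~~ b) ls.
Proof.
move=> C.
have S : sorted label_le (map label_opp (sort label_le ls)).
  rewrite sorted_map; have := sort_sorted label_le_total ls.
  apply: sub_in_sorted (allss _) => x y.
  rewrite !mem_sort => xl yl; rewrite /label_le /=.
  case/orP=> [->//|/andP[/eqP xy _]]; rewrite (C x y) // eqxx ltnn /=.
  by rewrite implybb.
rewrite (@perm_fan _ _ (map label_opp (sort label_le ls))); last first.
  by rewrite perm_map // perm_sym perm_sort.
rewrite fan_sorted // /fan -map_comp.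
by elim: (sort _ _) b => //= x l IH b; rewrite IH; case: (x.2); case: b.
Qed.

Lemma face_sum_rem (V : eqType) (g : seq V -> bool) s :
  (forall s1 s2, perm_eq s1 s2 -> g s1 = g s2) ->
  face_sum g s = \big[addb/false]_(v <- s) g (rem v s).
Proof.
elim: s g => [|v s IH] g gP; rewrite ?big_nil // big_cons /= eqxx; congr (_ (+) _).
rewrite IH => [|s1 s2 s12]; last by apply: gP; rewrite perm_cons.
rewrite !big_seq; apply: eq_bigr => w ws; apply: gP; case: eqP => // ->.
by rewrite perm_sym perm_to_rem.
Qed.

Lemma perm_face_sum (V : eqType) (g : seq V -> bool) s s' :
  (forall s1 s2, perm_eq s1 s2 -> g s1 = g s2) ->
  perm_eq s s' -> face_sum g s = face_sum g s'.
Proof.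
move=> gP ss; rewrite !face_sum_rem // (perm_big _ ss) /=.
apply: eq_bigr => v _; apply: gP; apply/permP => p.
by rewrite !count_rem (permP ss) (perm_mem ss).
Qed.

Lemma face_sum_fan b ls : face_sum (fan b) ls = fan b ls (+) fan (~~ b) ls.
Proof.
rewrite (perm_face_sum (perm_fan b) (s' := sort label_le ls)); last first.
  by rewrite perm_sym perm_sort.
rewrite /fan -face_sum_alternating -face_sum_map.
have: sorted label_le (sort label_le ls) by exact: sort_sorted label_le_total _.
have Q (g h : seq label -> bool) s :
    (forall l, subseq l s -> g l = h l) -> face_sum g s = face_sum h s.
  elim: s g h => [|v s IH] g h gh /=; [by []|]; rewrite (gh s (subseq_cons s v)).
  congr (_ (+) _).
  by apply: IH => l ls'; apply: gh; rewrite /= eqxx.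
move=> S; apply: Q => l /(subseq_sorted label_le_trans)/(_ S) Sl.
exact: fan_sorted.
Qed.

Lemma fan_dup b (l1 l2 : seq label) x : fan b (l1 ++ x :: x :: l2) = false.
Proof.
apply/negP => /fan_uniq; rewrite cat_uniq /= inE eqxx /=.
by rewrite !andbF.
Qed.

(** * Fan's parity argument *)

Section Tucker.
Variables (m N : nat) (lab : seq nat -> label).
Hypothesis lab_lt : forall v, ((lab v).1 < N)%N.
(** Thus [rcons v c] with [size v = d] can stand for a point of a face of dimension [d], whatever
    its later coordinates. *)
Hypothesis lab_ext : forall v c w, c = 0%N \/ c = m ->
  lab (v ++ c :: w) = lab (rcons v c).
Hypothesis lab_anti : forall v c, (size v < N)%N -> c = 0%N \/ c = m ->
  (forall i, (nth 0%N v i <= m)%N) ->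
  lab (antipode m (rcons v c)) = label_opp (lab (rcons v c)).
Hypothesis lab_adj : forall v w, size v = size w -> (size v <= N)%N ->
  (forall i, (nth 0%N v i <= m)%N) -> (forall i, (nth 0%N w i <= m)%N) ->
  (forall i, (nth 0%N v i <= (nth 0%N w i).+1)%N) ->
  (forall i, (nth 0%N w i <= (nth 0%N v i).+1)%N) ->
  (lab v).1 = (lab w).1 -> lab v = lab w.

(* The parity of the number of alternating simplices in [cube^d * {c}]. *)
Let X d c b := cube_sum m d (fun s => fan b (map (fun v => lab (rcons v c)) s)).

Lemma X_antipode d b : (d < N)%N -> X d 0%N b = X d m (~~ b).
Proof.
move=> dN; rewrite /X -cube_sum_antipode; apply: eq_cube_sum_supp => s _ sm s1.
rewrite (perm_fan b (ls' := map label_opp (map (fun v => lab (rcons v m)) s))).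
  rewrite fan_opp // => _ _ /mapP[v vs ->] /mapP[w ws ->].
  have [[sv vm] [sw wm]] := (sm _ vs, sm _ ws).
  apply: lab_adj => [||i|i|i|i]; rewrite ?size_rcons ?sv ?sw //
    !nth_rcons ?sv ?sw; do 2?case: ifP => //; rewrite ?s1 //.
rewrite map_rev perm_rev -!map_comp.
suff -> : [seq lab (rcons (antipode m v) 0) | v <- s] =
    [seq label_opp (lab (rcons v m)) | v <- s] by [].
apply/eq_in_map => v /sm[sv vm] /=.
by rewrite -lab_anti ?sv //; [rewrite /antipode map_rcons subnn | right].
Qed.

(** Stokes' formula for [fan true]. On a facet [x_j = c] with [j < d] the label ignores the last
    coordinate, so every slab simplex repeats a label and cannot alternate; only the end facets
    count. *)
Lemma X_step d (lab' : seq nat -> label) : (d < N)%N ->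
  (forall v c w, c = 0%N \/ c = m -> lab' (v ++ c :: w) = lab (rcons v c)) ->
  cube_sum m d.+1 (fun s => fan true (map lab' s)) (+)
  cube_sum m d.+1 (fun s => fan false (map lab' s)) = X d m true (+) X d 0%N true.
Proof.
move=> dN ext; rewrite -cube_sumD.
have E s : fan true (map lab' s) (+) fan false (map lab' s) =
    face_sum (fun l => fan true (map lab' l)) s.
  by rewrite face_sum_map face_sum_fan.
rewrite (eq_cube_sum _ _ E) cube_sum_face /=.
rewrite big1 => [|i _]; last first.
  apply: bound_sum_supp => // s j c jd Hc sP; apply: prism_sum_dup => v vs l1 l2.
  have [sv vj] := sP _ vs.
  rewrite map_cat /=.
  have lv k : lab' (rcons v k) = lab (rcons (take j v) c).
    rewrite -{1}(cat_take_drop j v) (drop_nth 0%N) ?sv // vj rcons_cat rcons_cons.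
    exact: ext.
  by rewrite !lv fan_dup.
rewrite addbF /X; congr (_ (+) _); apply: eq_cube_sum => s; rewrite -map_comp;
  congr fan; apply: eq_map => v /=; rewrite -[in LHS]cats1 ext; by [|left|right].
Qed.

Theorem fan_tucker : (0 < N)%N -> False.
Proof.
move=> N_gt0.
have X1 d : (d < N)%N -> X d m true (+) X d 0%N true.
  elim: d => [|d IH] dN.
    (* A single label alternates from exactly one of the two signs. *)
    rewrite X_antipode // /X /= /fan /=; case: (lab _) => i [] //.
  (* The top face is a cube of dimension [d + 1] labelled by [lab (rcons v m)]; its count for both
     signs equals the boundary count one dimension below. *)
  rewrite X_antipode // /X (X_step (lab' := fun v => lab (rcons v m)) (ltnW dN)).
    by apply: IH; exact: ltnW.
  by move=> v c w Hc; rewrite rcons_cat rcons_cons lab_ext.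
have := X1 N.-1; rewrite prednK // => /(_ (leqnn _)).
(* In dimension [N] a simplex has [N + 1] vertices, one more than there are absolute values. *)
rewrite -(X_step (lab' := lab)) ?prednK // -cube_sumD cube_sum_supp // => s ss sm s1.
have C : consistent (map lab s).
  move=> _ _ /mapP[v vs ->] /mapP[w ws ->].
  have [[sv vm] [sw wm]] := (sm _ vs, sm _ ws).
  by apply: lab_adj => [||i|i|i|i]; rewrite ?sv ?sw ?s1.
by rewrite !(@fan_oversize N) ?size_map ?ss // => x /mapP[v _ ->].
Qed.

End Tucker.

Local Open Scope classical_set_scope.
Local Open Scope ring_scope.

(** * Borsuk's theorem on the cube *)

Definition cube (R : realType) (N : nat) (x : 'rV[R]_N) : Prop :=
  forall j, `|x 0 j| <= 1.

(* Borsuk's theorem for a map odd on the boundary of the cube. As [f] depends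
   only on the coordinates up to one of modulus 1, it maps the boundary of
   [cube^d * {1}] to the images of [cube^(d-1) * {1}] and [cube^(d-1) * {-1}] up
   to degenerate cells, which spares triangulating hemispheres. *)
Lemma cube_zero (R : realType) (N : nat) (f : 'rV[R]_N -> 'rV[R]_N) (L : R) :
  (0 < N)%N ->
  (forall (x y : 'rV[R]_N) (d : R), cube x -> cube y ->
     (forall j, `|x 0 j - y 0 j| <= d) ->
     forall i, `|f x 0 i - f y 0 i| <= L * d) ->
  (forall x y j, cube x -> cube y -> `|x 0 j| = 1 ->
     (forall k : 'I_N, (k <= j)%N -> x 0 k = y 0 k) -> f x = f y) ->
  (forall x j, cube x -> `|x 0 j| = 1 -> f (- x) = - f x) ->
  exists2 x, cube x & f x = 0.
Proof.
move=> N_gt0 flip fext fodd.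
(* If [f] has no zero, this sum has a positive minimum over the compact cube. *)
pose g (x : 'rV[R]_N) : R := \sum_i `|f x 0 i|.
have g_ge0 x : 0 <= g x by apply: sumr_ge0 => i _.
have L_ge0 : 0 <= L.
  have c0 : cube (0 : 'rV[R]_N) by move=> j; rewrite mxE normr0.
  have := flip 0 0 1 c0 c0 _ (Ordinal N_gt0).
  by rewrite subrr normr0 mulr1; apply => j; rewrite subrr normr0.
have cptA : compact [set x : 'rV[R]_N | forall i, `[-1 : R, 1]%classic (x ord0 i)].
  by apply: (@rV_compact _ _ (fun=> `[-1 : R, 1]%classic)) => i; exact: segment_compact.
have cubeE x : cube x <-> (forall i, `[-1 : R, 1]%classic (x ord0 i)).
  by split => H i; have := H i; rewrite /= in_itv /= ler_norml.
have cg : {within [set x : 'rV[R]_N | forall i, `[-1 : R, 1]%classic (x ord0 i)],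
    continuous g}.
  apply/subspace_continuousP => x /= /cubeE Ax.
  apply/cvgrPdist_le => e e0; rewrite near_withinE.
  pose d := e / (N%:R * L + 1).
  have D0 : 0 < N%:R * L + 1 by rewrite ltr_wpDl // mulr_ge0.
  have d0 : 0 < d by rewrite divr_gt0.
  apply: filterS (@nbhsx_ballx _ _ x d d0) => y xyd /cubeE Ay.
  have xy j : `|x 0 j - y 0 j| <= d by apply: ltW; have [_ Hb] := xyd; exact: Hb.
  rewrite /g -sumrB (le_trans (ler_norm_sum _ _ _)) //.
  apply: (@le_trans _ _ (\sum_(i < N) L * d)).
    by apply: ler_sum => i _; apply: le_trans (ler_dist_dist _ _) _; exact: flip.
  rewrite sumr_const card_ord -mulr_natl mulrA /d mulrCA ler_piMr ?(ltW e0) //.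
  by rewrite ler_pdivrMr // mul1r lerDl.
have [|x0 x0A gmin] := EVT_min_rV _ cptA cg.
  by exists 0 => i /=; rewrite mxE in_itv /= lerN10 ler01.
have [g0|gx0] := eqVneq (g x0) 0.
  exists x0; first by apply/cubeE; move: x0A; rewrite inE.
  apply/rowP => i; rewrite mxE; apply/eqP; rewrite -normr_eq0.
  move/eqP: g0; rewrite psumr_eq0 // => /allP/(_ i).
  by rewrite mem_index_enum => /(_ isT).
(* The [N] moduli add up to at least [g x0] everywhere, so one of them is at least [delta]. *)
exfalso; pose delta := g x0 / N%:R.
have N0 : (0 : R) < N%:R by rewrite ltr0n.
have delta0 : 0 < delta by rewrite divr_gt0 // lt_neqAle eq_sym gx0 g_ge0.
have big x : cube x -> exists i, delta <= `|f x 0 i|.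
  move=> /cubeE xA; apply/existsP; apply: contraT; rewrite negb_exists => /forallP H.
  have := gmin x; rewrite inE => /(_ xA); rewrite leNgt => /negP[].
  rewrite -[ltRHS](@divfK _ N%:R) ?gt_eqF // -/delta mulr_natr -[N in ltRHS]card_ord.
  rewrite -sumr_const; apply: ltr_sum; last by move=> i _; rewrite ltNge H.
  by apply/hasP; exists (Ordinal N_gt0); rewrite ?mem_index_enum.
(* The mesh [2 / m] is so fine that each coordinate of [f] changes by less than [delta] along an
   edge. *)
pose m := (Num.bound (2 * L / delta)).+1.
have m0 : (0 : R) < m%:R by rewrite ltr0n.
have Lm : L * (2 / m%:R) < delta.
  rewrite mulrA ltr_pdivrMr // mulrC [ltRHS]mulrC -ltr_pdivrMr // mulrC.
  rewrite [L * 2]mulrC; apply: lt_le_trans (archi_boundP _) _.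
    by rewrite mulr_ge0 ?invr_ge0 ?(ltW delta0) // mulr_ge0.
  by rewrite ler_nat.
(* Truncating at [m] keeps the value in [[-1, 1]] for every natural number, since labels are defined
   on all lists. *)
pose pt k : R := -1 + 2 * ((minn k m)%:R / m%:R).
have pt0 : pt 0%N = -1 by rewrite /pt min0n mul0r mulr0 addr0.
have ptm : pt m = 1 by rewrite /pt minnn divff ?gt_eqF // mulr1; lra.
have pt_le1 k : `|pt k| <= 1.
  have : 0 <= (minn k m)%:R / m%:R :> R by rewrite divr_ge0.
  have : (minn k m)%:R / m%:R <= 1 :> R.
    by rewrite ler_pdivrMr // mul1r ler_nat geq_minr.
  by rewrite ler_norml /pt; lra.
have ptN k : (k <= m)%N -> pt (m - k)%N = - pt k.
  move=> km; rewrite /pt (minn_idPl km) (minn_idPl (leq_subr _ _)) natrB //.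
  by rewrite mulrBl divff ?gt_eqF //; lra.
have pt_adj k h : (k <= m)%N -> (h <= m)%N -> (k <= h.+1)%N -> (h <= k.+1)%N ->
    `|pt k - pt h| <= 2 / m%:R.
  move=> km hm kh hk; rewrite /pt (minn_idPl km) (minn_idPl hm).
  have -> : -1 + 2 * (k%:R / m%:R) - (-1 + 2 * (h%:R / m%:R)) =
    2 / m%:R * (k%:R - h%:R) :> R by field; rewrite gt_eqF.
  rewrite normrM ger0_norm ?divr_ge0 // ler_piMr ?divr_ge0 //.
  move: kh hk; rewrite -!(ler_nat R) -!natr1 ler_norml; lra.
(* Missing coordinates become 0, which is harmless after a coordinate of modulus 1 by [fext]. *)
pose row v : 'rV[R]_N := \row_j if (j < size v)%N then pt (nth 0%N v j) else 0.
have row_cube v : cube (row v).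
  by move=> j; rewrite mxE; case: ifP => // _; rewrite normr0.
(* Tucker's label: index and sign of a large coordinate. By [big] the default does not occur at
   images of points of the cube. *)
pose labf (y : 'rV[R]_N) : label := if [pick i | delta <= `|y 0 i|] is Some i
  then (i : nat, 0 < y 0 i) else (0%N, true).
have pt_bd c : c = 0%N \/ c = m -> `|pt c| = 1.
  by case=> ->; rewrite ?pt0 ?ptm ?normrN normr1.
apply: (@fan_tucker m N (fun v => labf (f (row v)))) => //.
- by move=> v; rewrite /labf; case: pickP => [i _|_] /=; rewrite ?ltn_ord.
- move=> v c w Hc; congr labf.
  have E (k : 'I_N) : (k <= size v)%N -> row (v ++ c :: w) 0 k = row (rcons v c) 0 k.
    move=> kv; rewrite !mxE size_cat size_rcons !ltnS kv /= addnS ltnS.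
    rewrite (leq_trans kv) ?leq_addr // nth_cat nth_rcons.
    by move: kv; case: ltngtP => // -> _; rewrite subnn.
  have [vN|Nv] := ltnP (size v) N.
    apply: (fext _ _ (Ordinal vN)) => //.
    by rewrite E //= mxE size_rcons /= ltnSn nth_rcons ltnn eqxx pt_bd.
  by congr f; apply/rowP => k; apply: E; apply: leq_trans Nv; exact: ltnW.
- move=> v c vN Hc vm.
  have -> : row (antipode m (rcons v c)) = - row (rcons v c).
    apply/rowP => k; rewrite !mxE size_map; case: ifP => [kv|_]; last by rewrite oppr0.
    rewrite (nth_map 0%N) // ptN // nth_rcons; case: ifP => // _; case: ifP => // _.
    by case: Hc => ->.
  rewrite (fodd _ (Ordinal vN)) //; last first.
    by rewrite mxE size_rcons /= ltnSn nth_rcons ltnn eqxx pt_bd.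
  rewrite /labf; set y := f _.
  have E : (fun i => delta <= `|(- y) 0 i|) =1 (fun i => delta <= `|y 0 i|).
    by move=> i; rewrite mxE normrN.
  rewrite (eq_pick E); case: pickP => [i yi|H]; last first.
    by have [i] := big _ (row_cube (rcons v c)); rewrite -/y H.
  rewrite /label_opp /= mxE oppr_gt0 -leNgt le_eqVlt; congr (_, _).
  by case: eqVneq yi => //= ->; rewrite normr0 leNgt delta0.
- move=> v w svw svN vm wm vw wv; rewrite /labf.
  case: pickP => [i vi|H]; last first.
    by have [i] := big _ (row_cube v); rewrite H.
  case: pickP => [j wj|H]; last first.
    by have [j] := big _ (row_cube w); rewrite H.
  move=> /= /val_inj ij; subst j; congr (_, _).
  (* Equal indices with opposite signs would force a difference of at least [2 * delta]. *)
  have D : `|f (row v) 0 i - f (row w) 0 i| < delta.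
    apply: le_lt_trans Lm; apply: flip => // k; rewrite !mxE -svw.
    by case: ifP => _; rewrite ?pt_adj // subrr normr0 divr_ge0.
  move: vi wj D; rewrite !ler_normr ltr_norml.
  by case: ltP; case: ltP => //; lra.
Qed.

(** * Reflection coefficients *)

(* The reflection coefficient seen from outside of layer [j] when [k] circles
   remain, i.e. the ratio of the decaying to the growing component of the mode
   on the outer side of circle [j]; [q j] is its attenuation between the
   circles [j] and [j.+1]. The value of [q] beyond the last circle is irrelevant,
   being multiplied by [0]. *)
Fixpoint refl (R : realType) (q eta : nat -> R) (k j : nat) : R :=
  if k is k'.+1 then
    let p := q j * refl q eta k' j.+1 in (eta j + p) / (1 + eta j * p)
  else 0.

(* The equations for the [n]-th Fourier coefficients of the densities, where
   [w j = r_j ^ (2n)]: [c - \sum_(k < j) x k] is the amplitude of the growing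
   component of the mode outside of circle [j], and the last sum that of its
   decaying component inside. *)
Definition layer_system (R : realType) (eta w : nat -> R) (N : nat) (c : R)
    (x : nat -> R) : Prop :=
  forall j, (j <= N)%N -> x j =
    eta j * (c - \sum_(0 <= k < j) x k + (\sum_(j.+1 <= k < N.+1) w k * x k) / w j).

Section Reflection.
Variables (R : realType) (q : nat -> R).
Hypothesis q_gt0 : forall j, 0 < q j.
Hypothesis q_lt1 : forall j, q j < 1.
Implicit Types (eta : nat -> R).

(** Strict attenuation keeps the denominator away from 0 even for contrasts of modulus 1. *)
Lemma refl_den eta k j : (forall i, `|eta i| <= 1) ->
  (forall i, `|refl q eta k i| <= 1) ->
  1 - q j <= 1 + eta j * (q j * refl q eta k j.+1).
Proof.
move=> eta1 t1.
have : `|eta j * (q j * refl q eta k j.+1)| <= q j.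
  rewrite !normrM (gtr0_norm (q_gt0 j)) mulrCA ler_piMr ?(ltW (q_gt0 j)) //.
  by rewrite mulr_ile1.
by rewrite ler_norml => /andP[]; lra.
Qed.

Lemma refl_le1 eta k j : (forall i, `|eta i| <= 1) -> `|refl q eta k j| <= 1.
Proof.
move=> eta1; elim: k j => [|k IH] j /=; first by rewrite normr0.
have := refl_den j eta1 IH; set p := q j * _ => Hp.
have p1 : `|p| <= 1.
  rewrite /p normrM (gtr0_norm (q_gt0 j)) mulr_ile1 ?(ltW (q_lt1 j)) //.
  exact: ltW.
have D0 : 0 < 1 + eta j * p by apply: lt_le_trans Hp; rewrite subr_gt0.
rewrite ler_norml ler_pdivlMr // ler_pdivrMr //.
move: p1 (eta1 j); rewrite !ler_norml => /andP[p1 p2] /andP[e1 e2].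
(* The two products are the denominator minus and plus the numerator. *)
have H1 : 0 <= (1 - eta j) * (1 - p) by apply: mulr_ge0; lra.
have H2 : 0 <= (1 + eta j) * (1 + p) by apply: mulr_ge0; lra.
by apply/andP; split; lra.
Qed.

Lemma refl_den_gt0 eta k j : (forall i, `|eta i| <= 1) ->
  0 < 1 + eta j * (q j * refl q eta k j.+1).
Proof.
move=> eta1; apply: lt_le_trans (refl_den j eta1 _); first by rewrite subr_gt0.
by move=> i; exact: refl_le1.
Qed.

Lemma refl_lip k j : exists2 L : R, 0 <= L &
  forall eta eta' d, (forall i, `|eta i| <= 1) -> (forall i, `|eta' i| <= 1) ->
  (forall i, `|eta i - eta' i| <= d) ->
  `|refl q eta k j - refl q eta' k j| <= L * d.
Proof.
elim: k j => [|k IH] j /=.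
  by exists 0 => // *; rewrite subrr normr0 mul0r.
have [L L0 HL] := IH j.+1.
exists (2 * (1 + L) / (1 - q j) ^+ 2).
  by rewrite divr_ge0 ?sqr_ge0 // mulr_ge0 // addr_ge0.
move=> eta eta' d e1 e1' ed.
have := refl_den_gt0 k j e1; have := refl_den_gt0 k j e1'.
have := refl_den j e1 (fun i => refl_le1 k i e1).
have := refl_den j e1' (fun i => refl_le1 k i e1').
have := HL _ _ _ e1 e1' ed.
have := refl_le1 k j.+1 e1; have := refl_le1 k j.+1 e1'.
set t := refl q eta k j.+1; set t' := refl q eta' k j.+1 => t1' t1 tt' D' D D0' D0.
(* The difference of the quotients splits into a part due to the contrast and a part due to the
   inner coefficient, which yields the constant chosen above. *)
have -> : (eta j + q j * t) / (1 + eta j * (q j * t)) -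
    (eta' j + q j * t') / (1 + eta' j * (q j * t')) =
    ((eta j - eta' j) * (1 - (q j * t) * (q j * t')) +
    q j * (t - t') * (1 - eta j * eta' j)) /
    ((1 + eta j * (q j * t)) * (1 + eta' j * (q j * t'))).
  by field; rewrite !gt_eqF.
have d0 : 0 <= d by apply: le_trans (ed 0%N).
have q1 : `|q j| <= 1 by rewrite gtr0_norm // ltW.
have B2 a b : `|a| <= 1 -> `|b| <= 1 -> `|1 - a * b| <= 2 :> R.
  move=> a1 b1; apply: le_trans (ler_normB _ _) _; rewrite normr1 normrM.
  have : `|a| * `|b| <= 1 by rewrite mulr_ile1.
  lra.
rewrite normrM normfV [`|(1 + _) * _|]gtr0_norm ?mulr_gt0 //.
rewrite [leRHS]mulrAC; apply: ler_pM.
- exact: normr_ge0.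
- by rewrite invr_ge0 mulr_ge0 // ltW.
- have -> : 2 * (1 + L) * d = d * 2 + 1 * (L * d) * 2 by ring.
  apply: le_trans (ler_normD _ _) _; rewrite !normrM; apply: lerD.
    by rewrite ler_pM // B2 // normrM mulr_ile1.
  by rewrite ler_pM ?B2 ?mulr_ge0 // ler_pM.
- rewrite lef_pV2 ?posrE ?mulr_gt0 ?exprn_gt0 ?subr_gt0 //.
  by rewrite expr2 ler_pM // subr_ge0 ltW.
Qed.

(** A contrast of modulus 1 is a perfect shield: [(eta + p) / (1 + eta p)] is then [eta], whatever
    [p] is. *)
Lemma refl_ext eta eta' k j i :
  (forall i, `|eta i| <= 1) -> (forall i, `|eta' i| <= 1) ->
  (i < k)%N -> `|eta (j + i)%N| = 1 ->
  (forall h, (h <= i)%N -> eta (j + h)%N = eta' (j + h)%N) ->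
  refl q eta k j = refl q eta' k j.
Proof.
move=> e1 e1'; elim: i j k => [|i IH] j [|k] //= ik ei ee.
  move: (ee 0%N isT) ei (refl_den_gt0 k j e1) (refl_den_gt0 k j e1').
  rewrite addn0 => <- /eqP; rewrite eqr_norml ler01 andbT => /orP[]/eqP-> D D'.
    by rewrite !mul1r !divff // gt_eqF //; move: D D'; rewrite !mul1r.
  have F p : 0 < 1 + -1 * p -> (-1 + p) / (1 + -1 * p) = -1 :> R.
    by move=> p0; apply: (canLR (mulfK _)); [rewrite gt_eqF|ring].
  by rewrite !F.
have := ee 0%N isT; rewrite addn0 => <-.
rewrite (IH j.+1 k) //; first by rewrite addSn -addnS.
by move=> h hi; rewrite addSn -addnS ee.
Qed.

Lemma refl_opp eta k j : refl q (fun i => - eta i) k j = - refl q eta k j.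
Proof.
elim: k j => [|k IH] j /=; first by rewrite oppr0.
by rewrite IH !mulrN mulNr opprK -opprD mulNr.
Qed.

(** Layers of zero contrast only attenuate the coefficient, by nonzero factors [q]. *)
Lemma refl_neq0 eta k j : (forall i, (i < k)%N -> eta (j + i)%N = 0) ->
  eta (j + k)%N != 0 -> refl q eta k.+1 j != 0.
Proof.
elim: k j => [|k IH] j e0 ek.
  by rewrite /= !mulr0 !addr0 divr1; rewrite addn0 in ek.
have -> : refl q eta k.+2 j = q j * refl q eta k.+1 j.+1.
  have := e0 0%N isT; rewrite addn0 /= => ->.
  by rewrite add0r mul0r addr0 divr1.
apply: mulf_neq0; first by rewrite gt_eqF.
by apply: IH; rewrite ?addSnnS // => i ik; rewrite addSnnS e0.
Qed.

(** * Existence and uniqueness for the layer system *)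

Section Layers.
Variables (eta w : nat -> R) (N : nat).
Hypothesis eta_le1 : forall i, `|eta i| <= 1.
Hypothesis w_gt0 : forall j, 0 < w j.
Hypothesis wq : forall j, (j < N)%N -> w j.+1 = q j * w j.

Local Notation in_amp c x j := (c - \sum_(0 <= k < j) x k).
Local Notation out_amp x j := (\sum_(j <= k < N.+1) w k * x k).

Let in_ampS (c : R) (x : nat -> R) j : in_amp c x j.+1 = in_amp c x j - x j.
Proof. by rewrite big_nat_recr //= opprD addrA. Qed.

Let out_ampS (x : nat -> R) j : (j <= N)%N -> out_amp x j = w j * x j + out_amp x j.+1.
Proof. by move=> jN; rewrite big_ltn. Qed.

Let w_refl k j : (j + k)%N = N ->
  w j.+1 * refl q eta k j.+1 = w j * (q j * refl q eta k j.+1).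
Proof.
case: k => [|k] jk; first by rewrite /= !mulr0.
by rewrite wq ?mulrA 1?[w j * _]mulrC // -jk addnS ltnS leq_addr.
Qed.

(** Induction from the innermost circle outwards, solving at each step the equation of circle [j]
    for [x j] in terms of the growing amplitude. *)
Lemma layer_response c x : layer_system eta w N c x ->
  forall k j, (j + k)%N = N.+1 -> out_amp x j = w j * refl q eta k j * in_amp c x j.
Proof.
move=> sys; elim=> [|k IH] j; first rewrite addn0 => ->.
  by rewrite big_geq // mulr0 mul0r.
rewrite addnS => -[jk]; have jN : (j <= N)%N by rewrite -jk leq_addr.
have := IH j.+1; rewrite addSn jk => /(_ erefl).
rewrite w_refl // in_ampS => Bj; have := sys j jN; rewrite (out_ampS x jN) Bj /=.
have D := refl_den_gt0 k j eta_le1.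
set p := q j * _ in D *; set A := in_amp c x j.
have -> : w j * p * (A - x j) / w j = p * (A - x j) by field; rewrite gt_eqF.
move=> xj; have {}xj : x j = eta j * (1 + p) * A / (1 + eta j * p).
  apply: (canRL (mulfK _)); first by rewrite gt_eqF.
  by rewrite mulrDr mulr1 {1}xj; ring.
by rewrite xj; field; rewrite gt_eqF.
Qed.

(** Going inwards, a zero growing amplitude forces [w j * (1 - p) * x j = 0] with [p < 1], so the
    next amplitude vanishes too. *)
Lemma layer_system0 x : layer_system eta w N 0 x -> forall j, (j <= N)%N -> x j = 0.
Proof.
move=> sys; have A0 j : (j <= N)%N -> in_amp 0 x j = 0 -> x j = 0.
  move=> jN A0; set p := q j * refl q eta (N - j) j.+1.
  have p1 : p < 1.
    apply: le_lt_trans (q_lt1 j); rewrite ler_piMr ?(ltW (q_gt0 j)) //.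
    by apply: le_trans (ler_norm _) _; exact: refl_le1.
  have := layer_response sys (k := N.+1 - j) (j := j).
  rewrite subnKC; last exact: leqW.
  have := layer_response sys (k := N - j) (j := j.+1).
  rewrite addSn subnKC // => /(_ erefl) B1 /(_ erefl).
  rewrite A0 mulr0 (out_ampS x jN) B1 in_ampS A0 sub0r w_refl ?subnKC // -/p => E.
  have {}E : w j * (1 - p) * x j = 0 by rewrite -[RHS]E; ring.
  apply/eqP; move/eqP: E.
  by rewrite !mulf_eq0 subr_eq0 (gt_eqF (w_gt0 j)) (gt_eqF p1).
have H j : (j <= N.+1)%N -> in_amp 0 x j = 0.
  elim: j => [|j IH] jN; first by rewrite big_geq // subr0.
  by rewrite in_ampS IH ?(ltnW jN) // A0 ?subr0 // IH // ltnW.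
by move=> j jN; rewrite A0 // H // leqW.
Qed.

Lemma layer_system_solvable c :
  exists2 x, layer_system eta w N c x & out_amp x 0 = w 0%N * refl q eta N.+1 0 * c.
Proof.
pose p j := q j * refl q eta (N - j) j.+1.
(* The growing amplitudes, with the factor obtained by eliminating [x j]; the [x j] are their
   decrements. *)
pose a := fix a j := if j is j'.+1 then
  (1 - eta j') / (1 + eta j' * p j') * a j' else c.
pose x j := a j - a j.+1.
have Ax j : in_amp c x j = a j.
  elim: j => [|j IH]; first by rewrite big_geq // subr0.
  by rewrite in_ampS IH /x opprB addrCA subrr addr0.
have xE j : x j = eta j * (1 + p j) / (1 + eta j * p j) * a j.
  by rewrite /x /=; field; rewrite gt_eqF // refl_den_gt0.
have Bx k : forall j, (j + k)%N = N.+1 -> out_amp x j = w j * refl q eta k j * a j.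
  elim: k => [|k IH] j; first rewrite addn0 => ->.
    by rewrite big_geq // mulr0 mul0r.
  rewrite addnS => -[jk]; have jN : (j <= N)%N by rewrite -jk leq_addr.
  rewrite (out_ampS x jN) IH ?addSn ?jk // w_refl // xE /= /p -jk addKn.
  by field; rewrite gt_eqF // refl_den_gt0.
exists x; last by rewrite (Bx N.+1).
move=> j jN; rewrite Ax (Bx (N - j)%N) ?addSn ?subnKC // w_refl ?subnKC // -/(p j).
rewrite xE /=; field; rewrite ?gt_eqF //= ?refl_den_gt0 //.
Qed.
End Layers.
End Reflection.

(** * A common zero of the reflection coefficients *)

Lemma append_contrast_lt (R : realType) (N : nat) (x : 'rV[R]_N) (e : R) (i : 'I_N) :
  append_contrast x e (inord i) = x 0 i.
Proof.
rewrite /append_contrast (_ : inord i = lift ord_max i) ?liftK //.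
by apply: val_inj; rewrite /= inordK ?ltnS ?(ltnW (ltn_ord i)) // /bump leqNgt ltn_ord.
Qed.

Lemma append_contrast_max (R : realType) (N : nat) (x : 'rV[R]_N) (e : R) :
  append_contrast x e (inord N) = e.
Proof.
rewrite /append_contrast (_ : inord N = ord_max) ?unlift_none //.
by apply: val_inj; rewrite /= inordK.
Qed.

Lemma append_contrast_le1 (R : realType) (N : nat) (x : 'rV[R]_N) (e : R) k :
  cube x -> `|e| <= 1 -> `|append_contrast x e k| <= 1.
Proof. by move=> x1 e1; rewrite /append_contrast; case: unliftP. Qed.

Lemma exists_contrasts (R : realType) (N : nat) (q : 'I_N -> nat -> R) (e : R) :
  (0 < N)%N -> (forall i j, 0 < q i j < 1) -> `|e| <= 1 ->
  exists x : 'rV[R]_N, [/\ cube x, e != 0 -> x != 0 &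
    forall i, refl (q i) (fun j => append_contrast x e (inord j)) N.+1 0 = 0].
Proof.
move=> N0 q01 e1.
have q0 i j : 0 < q i j by case/andP: (q01 i j).
have q1 i j : q i j < 1 by case/andP: (q01 i j).
pose eta (x : 'rV[R]_N) (j : nat) := append_contrast x e (inord j) : R.
have eta1 x : cube x -> forall j, `|eta x j| <= 1.
  by move=> x1 j; exact: append_contrast_le1.
pose f (x : 'rV[R]_N) : 'rV[R]_N := \row_i refl (q i) (eta x) N.+1 0.
have /choice[L HL] : forall i, exists L : R, 0 <= L /\
    forall (et et' : nat -> R) (d : R),
    (forall i, `|et i| <= 1) -> (forall i, `|et' i| <= 1) ->
    (forall i, `|et i - et' i| <= d) ->
    `|refl (q i) et N.+1 0 - refl (q i) et' N.+1 0| <= L * d.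
  by move=> i; have [L] := refl_lip (q0 i) (q1 i) N.+1 0; exists L.
(* Oddness of [refl] would also negate the innermost contrast [e]; the shielding layer [j] hides
   that change. *)
have etaN x j (y := - x) : cube x -> `|x 0 j| = 1 ->
    forall i, refl (q i) (eta y) N.+1 0 = - refl (q i) (eta x) N.+1 0.
  move=> x1 xj i; rewrite -refl_opp; apply: (refl_ext (q0 i) (q1 i) (i := j)) => //.
  - by apply: eta1 => k; rewrite mxE normrN.
  - by move=> k; rewrite normrN; exact: eta1.
  - exact: leqW.
  - by rewrite add0n /eta append_contrast_lt mxE normrN.
  - move=> h hj; rewrite add0n /eta.
    have hN := leq_ltn_trans hj (ltn_ord j).
    by do 2!rewrite (append_contrast_lt _ _ (Ordinal hN)); rewrite mxE.
have [x y d cx cy xyd i|x y j cx cy xj xy|x j cx xj|x cx fx] :=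
    @cube_zero R N f (\sum_i L i) N0.
- rewrite !mxE; apply: (@le_trans _ _ (L i * d)).
    apply: (HL i).2; [exact: eta1|exact: eta1|] => k.
    have d0 : 0 <= d by apply: le_trans (xyd (Ordinal N0)).
    rewrite /eta /append_contrast; case: unliftP => [h _|_] //.
    by rewrite subrr normr0.
  have d0 : 0 <= d by apply: le_trans (xyd i).
  rewrite ler_wpM2r // (bigD1 i) //= lerDl sumr_ge0 // => k _.
  exact: (HL k).1.
- apply/rowP => i; rewrite !mxE; apply: (refl_ext (q0 i) (q1 i) (i := j)) => //;
    try exact: eta1.
  + exact: leqW.
  + by rewrite add0n /eta append_contrast_lt.
  + move=> h hj; rewrite add0n /eta.
    have hN := leq_ltn_trans hj (ltn_ord j).
    by rewrite !(append_contrast_lt _ _ (Ordinal hN)) xy.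
- by apply/rowP => i; rewrite !mxE (etaN _ j).
exists x; split => // [e0|i]; last first.
  by move/rowP: fx => /(_ i); rewrite !mxE.
(* For [x = 0] only the nonzero innermost contrast is left, so the coefficients could not vanish. *)
apply: contra_eq_neq fx => ->; apply/eqP => /rowP/(_ (Ordinal N0)); rewrite !mxE.
apply/eqP; apply: refl_neq0 => // [i iN|]; rewrite add0n /eta.
  by rewrite (append_contrast_lt _ _ (Ordinal iN)) mxE.
by rewrite append_contrast_max.
Qed.

(** * Integration over a period *)

Definition pint (R : realType) (g : R -> R) : R :=
  \int[lebesgue_measure]_(t in period R) g t.

Definition pintegrable (R : realType) (g : R -> R) : Prop :=
  lebesgue_measure.-integrable (period R) (EFin \o g).

Section PeriodIntegral.
Variable R : realType.
Implicit Types (g h : R -> R) (c : R).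
Local Notation mu := (@lebesgue_measure R).

Lemma measurable_period : measurable (period R : set (measurableTypeR R)).
Proof. exact: measurable_itv. Qed.
Hint Resolve measurable_period : core.

Lemma twopi_gt0 : 0 < 2 * pi :> R.
Proof. by rewrite mulr_gt0 // pi_gt0. Qed.

Lemma mu_period : mu (period R) = (2 * pi)%:E.
Proof.
by rewrite /period lebesgue_measure_itv /= lte_fin twopi_gt0 oppr0 adde0.
Qed.

Lemma pintegrableD g h : pintegrable g -> pintegrable h ->
  pintegrable (fun t => g t + h t).
Proof. by move=> ig ih; exact: (integrableD measurable_period ig ih). Qed.

Lemma pintegrableB g h : pintegrable g -> pintegrable h ->
  pintegrable (fun t => g t - h t).
Proof. by move=> ig ih; exact: (integrableB measurable_period ig ih). Qed.

Lemma pintegrableZ c g : pintegrable g -> pintegrable (fun t => c * g t).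
Proof. by move=> ig; exact: (integrableZl measurable_period c ig). Qed.

Lemma pintegrable_sum (I : Type) (s : seq I) (P : pred I) (g : I -> R -> R) :
  (forall i, P i -> pintegrable (g i)) ->
  pintegrable (fun t => \sum_(i <- s | P i) g i t).
Proof.
move=> ig; have := integrable_sum (mu := mu) measurable_period s ig.
apply: eq_integrable => // t _ /=.
by rewrite sumEFin.
Qed.

Lemma measurable_continuous h : continuous h -> measurable_fun (period R) h.
Proof.
move=> ch; apply: subspace_continuous_measurable_fun => //.
exact: continuous_subspaceT.
Qed.

Lemma pintegrableM h g : measurable_fun (period R) h ->
  (exists M, forall t, `|h t| <= M) -> pintegrable g ->
  pintegrable (fun t => h t * g t).
Proof.
move=> mh [M hM] ig.
apply: (integrableMr measurable_period mh _ ig).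
by exists M; split; [exact: num_real|move=> x Mx t _ /=; apply: le_trans (ltW Mx)].
Qed.

Lemma pintegrable_continuous h : continuous h -> pintegrable h.
Proof.
move=> ch; apply: continuous_compact_integrable; first exact: segment_compact.
exact: continuous_subspaceT.
Qed.

Lemma pintD g h : pintegrable g -> pintegrable h ->
  pint (fun t => g t + h t) = pint g + pint h.
Proof. by move=> ig ih; rewrite /pint RintegralD. Qed.

Lemma pintB g h : pintegrable g -> pintegrable h ->
  pint (fun t => g t - h t) = pint g - pint h.
Proof. by move=> ig ih; rewrite /pint RintegralB. Qed.

Lemma pintZ c g : pintegrable g -> pint (fun t => c * g t) = c * pint g.
Proof. by move=> ig; rewrite /pint RintegralZl. Qed.

Lemma pint_cst c : pint (fun=> c) = c * (2 * pi).
Proof. by rewrite /pint Rintegral_cst // -[2 * pi]/(fine (2 * pi)%:E) -mu_period. Qed.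

Lemma eq_pint g h : (forall t, period R t -> g t = h t) -> pint g = pint h.
Proof. by move=> gh; apply: eq_Rintegral => t; rewrite inE => /gh. Qed.

Lemma pint_sum (I : Type) (s : seq I) (P : pred I) (g : I -> R -> R) :
  (forall i, P i -> pintegrable (g i)) ->
  pint (fun t => \sum_(i <- s | P i) g i t) = \sum_(i <- s | P i) pint (g i).
Proof.
move=> ig; elim: s => [|i s IH].
  rewrite big_nil -[RHS](mul0r (2 * pi)) -pint_cst.
  by apply: eq_pint => t _; rewrite big_nil.
rewrite big_cons; case: ifP => Pi; rewrite -IH.
  rewrite -pintD; [|exact: ig|exact: pintegrable_sum].
  by apply: eq_pint => t _; rewrite big_cons Pi.
by apply: eq_pint => t _; rewrite big_cons Pi.
Qed.

Lemma pint_norm_le g h : pintegrable g -> pintegrable h ->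
  (forall t, period R t -> `|g t| <= h t) -> `|pint g| <= pint h.
Proof.
move=> ig ih gh; apply: le_trans (le_normr_Rintegral _ _) _ => //.
by apply: le_Rintegral => //; exact: integrable_norm.
Qed.

Lemma ae_filter_lebesgue : Filter (almost_everywhere mu).
Proof. exact: (ae_filter_ringOfSetsType mu). Qed.

Lemma pint_ae g h : pintegrable g -> pintegrable h ->
  {ae mu, forall t, period R t -> g t = h t} -> pint g = pint h.
Proof.
move=> ig ih gh; congr fine; apply: ae_eq_integral => //.
- exact: measurable_int ig.
- exact: measurable_int ih.
- by apply: (@filterS _ _ ae_filter_lebesgue _ _ _ gh) => t H Pt; rewrite /= H.
Qed.

Lemma pint_ae_bound g c : 0 <= c -> pintegrable g ->
  {ae mu, forall t, period R t -> `|g t| <= c} -> `|pint g| <= c * (2 * pi).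
Proof.
move=> c0 ig gc; apply: le_trans (le_normr_Rintegral _ ig) _ => //.
have ing : pintegrable (fun t => `|g t|) by exact: integrable_norm.
have ic : pintegrable (fun=> c) by apply: pintegrable_continuous; exact: cst_continuous.
rewrite -pint_cst fine_le //; [exact: integrable_fin_num..|].
by apply: ae_ge0_le_integral => //; exact: measurable_int ing.
Qed.

(** Nothing is assumed about [g] at the points of [s], such as the pole of a kernel; [h] is
    corrected there one point at a time by a multiple of an indicator. *)
Lemma pint_finite (s : seq R) g h : pintegrable h ->
  (forall t, period R t -> t \notin s -> g t = h t) -> pint g = pint h.
Proof.
elim: s h => [|r s IH] h ih gh; first by apply: eq_pint => t Pt; exact: gh.
pose k t := (g r - h r) * \1_[set r] t.
have ik : pintegrable k.
  apply: pintegrableZ; apply: measurable_bounded_integrable => //.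
    by rewrite [X in (X < _)%E]mu_period ltry.
    exists 1; split => // M M1 t _; apply: le_trans (ltW M1).
    by rewrite /= indicE ger0_norm // lern1 leq_b1.
have ihk : pintegrable (fun t => h t + k t) by exact: pintegrableD.
rewrite (IH _ ihk) => [|t Pt ts].
  apply: pint_ae => //; exists [set r]; split => //.
    exact: lebesgue_measure_set1.
  move=> t /= H; apply: contrapT => tr; apply: H => _.
  by rewrite /k indicE memNset // mulr0 addr0.
rewrite /k indicE; have [->|tr] := eqVneq t r.
  by rewrite mem_set // mulr1 subrKC.
rewrite memNset ?mulr0 ?addr0; last by move=> /= /eqP; exact/negP.
by rewrite gh // inE negb_or tr.
Qed.

Lemma continuous_cosl a b : continuous (fun t : R => cos (a * t - b)).
Proof.
move=> t; apply: continuous_comp; last exact: continuous_cos.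
by apply: continuousB; [exact: mulrl_continuous|exact: cst_continuous].
Qed.

Lemma pint_cos (k : nat) (a : R) :
  pint (fun t : R => cos (k%:R * t - a)) = if k == 0%N then 2 * pi * cos a else 0.
Proof.
case: eqP => [->|/eqP k0].
  rewrite mulrC -pint_cst; apply: eq_pint => t _.
  by rewrite mul0r sub0r cosN.
pose F (t : R) := k%:R^-1 * sin (k%:R * t - a).
have dF (t : R) : is_derive t (1 : R) F (cos (k%:R * t - a)).
  rewrite /F; apply: is_derive_eq.
  by rewrite /GRing.scale /= subr0 mulr1 mulrCA mulVf ?mulr1 // pnatr_eq0.
have cF : continuous F.
  move=> t; apply: differentiable_continuous; apply/derivable1_diffP.
  by case: (dF t).
rewrite /pint /Rintegral.
rewrite (@continuous_FTC2 R (fun t => cos (k%:R * t - a)) F) ?twopi_gt0 //.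
- have -> : F (2 * pi) = F 0.
    rewrite /F mulr0 sub0r; congr (_ * _).
    have -> : k%:R * (2 * pi) - a = - a + (pi *+ 2) *+ k.
      by rewrite -[X in _ = _ + X]mulr_natl -[pi *+ 2]mulr_natl addrC.
    by rewrite (periodicn (@sinD2pi R)).
  by rewrite subee.
- exact/continuous_subspaceT/continuous_cosl.
- split; first by move=> t _; case: (dF t).
    exact: cvg_at_right_filter (cF 0).
  exact: cvg_at_left_filter (cF (2 * pi)).
- by move=> t _; rewrite derive1E; case: (dF t).
Qed.

Lemma pint_cos_cos (n m : nat) (a b : R) : (0 < n)%N ->
  pint (fun t : R => cos (n%:R * t - a) * cos (m%:R * t - b)) =
  if n == m then pi * cos (a - b) else 0.
Proof.
move=> n0.
have ic (k : nat) (c : R) : pintegrable (fun t : R => cos (k%:R * t - c)).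
  exact/pintegrable_continuous/continuous_cosl.
have H (k : nat) (c : R) : (forall t : R,
    cos (n%:R * t - a) * cos (m%:R * t - b) =
    2^-1 * (cos ((n + m)%:R * t - (a + b)) + cos (k%:R * t - c))) ->
    pint (fun t : R => cos (n%:R * t - a) * cos (m%:R * t - b)) =
    if k == 0%N then pi * cos c else 0.
  move=> E; under [X in pint X]eq_fun do rewrite E.
  rewrite pintZ; last exact: pintegrableD.
  rewrite pintD // !pint_cos addn_eq0 [n == 0%N]gtn_eqF //= add0r.
  by case: ifP => _; rewrite ?mulr0 // -mulrA mulrA mulVf ?mul1r.
have coscos (x y : R) : cos x * cos y = 2^-1 * (cos (x + y) + cos (x - y)).
  by rewrite cosD cosB; field.
have [nm|mn|nm] := ltngtP n m.
- rewrite (H (m - n)%N (b - a)) ?subn_eq0 1?leqNgt ?nm // => t.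
  rewrite coscos -[cos (_ - (_ - _))]cosN natrB ?(ltnW nm) // natrD.
  by congr (_ * (cos _ + cos _)); ring.
- rewrite (H (n - m)%N (a - b)) ?subn_eq0 1?leqNgt ?mn // => t.
  rewrite coscos natrB ?(ltnW mn) // natrD.
  by congr (_ * (cos _ + cos _)); ring.
- rewrite (H 0%N (a - b)) // => t; rewrite coscos nm natrD.
  by congr (_ * (cos _ + cos _)); ring.
Qed.
End PeriodIntegral.

(** * Convolution with the Poisson kernel *)

Lemma geometric_squeeze (R : realType) (x B q : R) (M0 : nat) :
  0 <= q < 1 -> (forall M, (M0 <= M)%N -> `|x| <= B * q ^+ M) -> x = 0.
Proof.
move=> /andP[q0 q1] H; apply/eqP; rewrite -normr_le0.
have C : (fun M => B * q ^+ M) @ \oo --> (0 : R).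
  rewrite -[X in _ --> X](mulr0 B); apply: cvgMr.
  by apply: cvg_expr; rewrite ger0_norm.
apply: (ler_cvg_to (cvg_cst `|x|) C).
by exists M0 => // M; exact: H.
Qed.

Section PoissonKernel.
Variable R : realType.
Implicit Types (q Q t s th : R) (g : R -> R).
Local Notation mu := (@lebesgue_measure R).

(* The real part of [1 / (1 - q e^(i th))]. *)
Definition pker q th : R := (1 - q * cos th) / (1 - 2 * q * cos th + q ^+ 2).

Lemma pker_den q th : 0 <= q -> (1 - q) ^+ 2 <= 1 - 2 * q * cos th + q ^+ 2.
Proof.
move=> q0; have : q * cos th <= q by rewrite ler_piMr // cos_le1.
by rewrite !expr2; lra.
Qed.

Lemma pker_den_gt0 q th : 0 <= q < 1 -> 0 < 1 - 2 * q * cos th + q ^+ 2.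
Proof.
move=> /andP[q0 q1]; apply: lt_le_trans (pker_den _ q0).
by rewrite exprn_gt0 // subr_gt0.
Qed.

(** The real part of a finite geometric sum, by induction on the recurrence of [cos (m th)]. *)
Lemma pker_partial_sum q th M :
  (1 - 2 * q * cos th + q ^+ 2) * \sum_(0 <= m < M.+1) q ^+ m * cos (m%:R * th) =
  1 - q * cos th - q ^+ M.+1 * cos (M.+1%:R * th) + q ^+ M.+2 * cos (M%:R * th).
Proof.
elim: M => [|M IH].
  by rewrite big_nat1 mul0r cos0 (_ : 1%:R * th = th) ?mul1r //; ring.
rewrite big_nat_recr //= mulrDr IH.
have -> : cos (M.+2%:R * th) = 2 * cos th * cos (M.+1%:R * th) - cos (M%:R * th).
  have -> : M.+2%:R * th = M.+1%:R * th + th by rewrite -!natr1; ring.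
  have -> : M%:R * th = M.+1%:R * th - th by rewrite -!natr1; ring.
  by rewrite cosD cosB; ring.
by rewrite !exprS; ring.
Qed.

(** The bound is uniform in [q <= Q], so one rate serves finitely many kernels. *)
Lemma pker_approx q Q th M : 0 <= q -> q <= Q -> Q < 1 ->
  `|pker q th - \sum_(0 <= m < M.+1) q ^+ m * cos (m%:R * th)| <=
  2 / (1 - Q) ^+ 2 * Q ^+ M.
Proof.
move=> q0 qQ Q1; have q1 := le_lt_trans qQ Q1.
have q01 : 0 <= q < 1 by rewrite q0.
have D0 := pker_den_gt0 th q01; have Q0 := le_trans q0 qQ.
have -> : pker q th - \sum_(0 <= m < M.+1) q ^+ m * cos (m%:R * th) =
   (q ^+ M.+1 * cos (M.+1%:R * th) - q ^+ M.+2 * cos (M%:R * th)) /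
   (1 - 2 * q * cos th + q ^+ 2).
  apply: (canRL (mulfK _)); first by rewrite gt_eqF.
  rewrite mulrBl mulfVK ?gt_eqF // [_ * (1 - _ + _)]mulrC pker_partial_sum; ring.
rewrite normrM normfV (gtr0_norm D0) [leRHS]mulrAC; apply: ler_pM => //.
- by rewrite invr_ge0 ltW.
- apply: le_trans (ler_normB _ _) _.
  rewrite [`|q ^+ M.+1 * _|]normrM [`|q ^+ M.+2 * _|]normrM.
  have B h c : `|cos c| <= 1 -> (M <= h)%N -> `|q ^+ h| * `|cos c| <= Q ^+ M.
    move=> c1 Mh; rewrite ger0_norm ?exprn_ge0 //.
    apply: (@le_trans _ _ (q ^+ h)); first by rewrite ler_piMr ?exprn_ge0.
    apply: (@le_trans _ _ (q ^+ M)); last by rewrite lerXn2r ?nnegrE.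
    by rewrite ler_wiXn2l // ltW.
  rewrite (_ : 2 * _ = Q ^+ M + Q ^+ M); last by ring.
  by apply: lerD; apply: B; rewrite ?cos_max // ltnW.
- rewrite lef_pV2 ?posrE ?exprn_gt0 ?subr_gt0 //.
  apply: le_trans (pker_den _ q0).
  by apply: lerXn2r; rewrite ?nnegrE; lra.
Qed.

Lemma continuous_pker q t : 0 <= q < 1 -> continuous (fun u : R => pker q (t - u)).
Proof.
move=> q01 u; have cc : {for u, continuous (fun u : R => cos (t - u))}.
  apply: continuous_comp; last exact: continuous_cos.
  by apply: continuousB; [exact: cst_continuous|exact: id].
apply: cvgM.
  by apply: cvgB; [exact: cvg_cst|apply: cvgMr; exact: cc].
apply: cvgV; first by rewrite gt_eqF // pker_den_gt0.
apply: cvgD; last exact: cvg_cst.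
by apply: cvgB; [exact: cvg_cst|apply: cvgMr; exact: cc].
Qed.

Lemma pker_bounded q t u : 0 <= q < 1 -> `|pker q (t - u)| <= 2 / (1 - q) ^+ 2.
Proof.
move=> q01; have /andP[q0 q1] := q01.
rewrite normrM normfV (gtr0_norm (pker_den_gt0 _ q01)); apply: ler_pM => //.
- by rewrite invr_ge0 ltW // pker_den_gt0.
- apply: le_trans (ler_normB _ _) _; rewrite normr1 lerD2l normrM ger0_norm //.
  by rewrite mulr_ile1 // ?cos_max // ltW.
- rewrite lef_pV2 ?posrE ?exprn_gt0 ?subr_gt0 ?pker_den_gt0 //.
  exact: pker_den.
Qed.

Definition conv_pker q g t : R := pint (fun u => pker q (t - u) * g u).

(** For [n > 0], this is [pi] times the component of frequency [n] of [g], sine and cosine parts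
    together, evaluated at [t]. *)
Definition mode (n : nat) g t : R :=
  pint (fun u => cos (n%:R * u - n%:R * t) * g u).

Lemma pintegrable_cosM a b g : pintegrable g ->
  pintegrable (fun u => cos (a * u - b) * g u).
Proof.
move=> ig; apply: pintegrableM ig.
  by apply: measurable_continuous; exact: continuous_cosl.
by exists 1 => u; exact: cos_max.
Qed.

Lemma pintegrable_pkerM q t g : 0 <= q < 1 -> pintegrable g ->
  pintegrable (fun u => pker q (t - u) * g u).
Proof.
move=> q01 ig; apply: pintegrableM ig.
  by apply: measurable_continuous; exact: continuous_pker.
by exists (2 / (1 - q) ^+ 2) => u; exact: pker_bounded.
Qed.

Lemma conv_pker_approx q Q g t M : 0 <= q -> q <= Q -> Q < 1 ->
  pintegrable g -> pint g = 0 ->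
  `|conv_pker q g t - \sum_(1 <= m < M.+1) q ^+ m * mode m g t| <=
  2 / (1 - Q) ^+ 2 * pint (fun u => `|g u|) * Q ^+ M.
Proof.
move=> q0 qQ Q1 ig g0; have q1 := le_lt_trans qQ Q1.
have q01 : 0 <= q < 1 by rewrite q0.
have ing : pintegrable (fun u => `|g u|) by exact: integrable_norm.
have -> : \sum_(1 <= m < M.+1) q ^+ m * mode m g t =
  pint (fun u => (\sum_(0 <= m < M.+1) q ^+ m * cos (m%:R * (t - u))) * g u).
  (* The term [m = 0] can be added because [g] has mean zero. *)
  transitivity (\sum_(0 <= m < M.+1) q ^+ m * mode m g t).
    rewrite [RHS]big_ltn // [X in X + _](_ : _ = 0) ?add0r // /mode expr0 mul1r.
    by rewrite -[RHS]g0; apply: eq_pint => u _; rewrite !mul0r subrr cos0 mul1r.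
  under [X in pint X]eq_fun => u.
    rewrite mulr_suml.
    under eq_bigr => m _ do rewrite -mulrA -cosN -mulrN opprB mulrBr.
    over.
  rewrite pint_sum => [|m _]; last exact/pintegrableZ/pintegrable_cosM.
  by apply: eq_bigr => m _; rewrite pintZ //; exact: pintegrable_cosM.
rewrite /conv_pker -pintB; last 2 first.
- exact: pintegrable_pkerM.
- under [X in pintegrable X]eq_fun => u.
    rewrite mulr_suml.
    under eq_bigr => m _ do rewrite -mulrA -cosN -mulrN opprB mulrBr.
    over.
  by apply: pintegrable_sum => m _; exact/pintegrableZ/pintegrable_cosM.
rewrite mulrAC -pintZ //; apply: pint_norm_le; last 1 first.
- move=> u _; rewrite -mulrBl normrM ler_wpM2r //.
  exact: pker_approx.
- apply: pintegrableB; first exact: pintegrable_pkerM.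
  under [X in pintegrable X]eq_fun => u.
    rewrite mulr_suml.
    under eq_bigr => m _ do rewrite -mulrA -cosN -mulrN opprB mulrBr.
    over.
  by apply: pintegrable_sum => m _; exact/pintegrableZ/pintegrable_cosM.
- exact: pintegrableZ.
Qed.

Lemma mode_trig n g t : pintegrable g ->
  mode n g t = cos (n%:R * t - 0) * pint (fun u => cos (n%:R * u - 0) * g u) +
    cos (n%:R * t - pi / 2) * pint (fun u => cos (n%:R * u - pi / 2) * g u).
Proof.
move=> ig; rewrite -!pintZ; [|exact: pintegrable_cosM..].
rewrite -pintD; [|exact/pintegrableZ/pintegrable_cosM..].
by apply: eq_pint => u _; rewrite !cosBpihalf !subr0 cosB; ring.
Qed.

Lemma continuous_mode n g : pintegrable g -> continuous (mode n g).
Proof.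
move=> ig t; rewrite (funext (fun s => mode_trig n s ig)).
by apply: cvgD; (apply: cvgM; [exact: continuous_cosl|exact: cvg_cst]).
Qed.

Lemma pint_cos_mode (n m : nat) a g : (0 < n)%N -> pintegrable g ->
  pint (fun t => cos (n%:R * t - a) * mode m g t) =
  if n == m then pi * pint (fun u => cos (n%:R * u - a) * g u) else 0.
Proof.
move=> n0 ig.
have icc b : pintegrable (fun t : R => cos (n%:R * t - a) * cos (m%:R * t - b)).
  by apply: pintegrable_cosM; apply: pintegrable_continuous; exact: continuous_cosl.
under [X in pint X]eq_fun do rewrite mode_trig // mulrDr !mulrA ![_ * pint _]mulrC.
rewrite pintD; [|exact: pintegrableZ..].
rewrite !pintZ // !pint_cos_cos //.
case: eqP => [->|_]; last by rewrite !mulr0 addr0.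
rewrite !(mulrC (pint _)) -!mulrA -mulrDr; congr (_ * _).
rewrite -!pintZ; [|exact: pintegrable_cosM..].
rewrite -pintD; [|exact/pintegrableZ/pintegrable_cosM..].
by apply: eq_pint => u _; rewrite !cosBpihalf !subr0 cosB; ring.
Qed.

(** By orthogonality the truncated series no longer changes once [M] reaches [n], while its error
    tends to 0. *)
Lemma conv_pker_cos q (n : nat) b t : 0 <= q < 1 -> (0 < n)%N ->
  conv_pker q (fun u => cos (n%:R * u - b)) t = pi * q ^+ n * cos (n%:R * t - b).
Proof.
move=> q01 n0; have /andP[q0 q1] := q01; apply/eqP; rewrite -subr_eq0; apply/eqP.
set g := (fun u : R => cos (n%:R * u - b)).
have ig : pintegrable g by apply: pintegrable_continuous; exact: continuous_cosl.
apply: (@geometric_squeeze _ _ (2 / (1 - q) ^+ 2 * pint (fun u => `|g u|)) q n) => //.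
move=> M nM; have g0 : pint g = 0 by rewrite /g pint_cos gtn_eqF.
have := conv_pker_approx t M q0 (lexx q) q1 ig g0.
suff -> : \sum_(1 <= m < M.+1) q ^+ m * mode m g t = pi * q ^+ n * g t by [].
rewrite (bigD1_seq n) ?mem_index_iota ?n0 ?ltnS ?iota_uniq //= big1 ?addr0 => [|m mn].
  by rewrite /mode pint_cos_cos // eqxx /g mulrCA mulrA.
rewrite /mode /g; have [m0|m0] := posnP m.
  rewrite -[RHS](mulr0 (q ^+ m)) -g0; congr (_ * _).
  by apply: eq_pint => u _; rewrite m0 !mul0r subrr cos0 mul1r.
by rewrite pint_cos_cos // (negPf mn) mulr0.
Qed.

End PoissonKernel.

(** * Homogeneous systems of Poisson convolutions *)

Section ConvolutionSystem.
Variables (R : realType) (n : nat).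
Variables (kap q : 'I_n -> 'I_n -> R) (d : 'I_n -> R -> R).
Local Notation mu := (@lebesgue_measure R).
Hypothesis q01 : forall j k, 0 <= q j k < 1.
Hypothesis d_int : forall j, pintegrable (d j).
Hypothesis d_mean : forall j, pint (d j) = 0.
Hypothesis d_eq : forall j, {ae mu, forall t, period R t ->
  d j t = \sum_(k < n | k != j) kap j k * conv_pker (q j k) (d k) t}.

Let q_uniform : exists Q, 0 <= Q < 1 /\ forall j k, q j k <= Q.
Proof.
exists (\big[Order.max/0]_(p : 'I_n * 'I_n) q p.1 p.2); split.
  apply/andP; split; first exact: bigmax_ge_id.
  by apply/bigmax_ltP; split => // p _; case/andP: (q01 p.1 p.2).
by move=> j k; apply: (le_bigmax _ _ (j, k)).
Qed.

Let partial j M t := \sum_(k < n | k != j)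
  kap j k * \sum_(1 <= m < M.+1) q j k ^+ m * mode m (d k) t.

Let partial_approx j : exists B Q : R, [/\ 0 <= B, 0 <= Q < 1 &
  {ae mu, forall t, period R t -> forall M, `|d j t - partial j M t| <= B * Q ^+ M}].
Proof.
have [Q [/[dup] Q01 /andP[Q0 Q1] qQ]] := q_uniform.
exists (\sum_(k < n | k != j) `|kap j k| *
  (2 / (1 - Q) ^+ 2 * pint (fun u => `|d k u|))), Q; split => //.
  apply: sumr_ge0 => k _; rewrite mulr_ge0 // mulr_ge0 ?divr_ge0 ?sqr_ge0 //.
  exact: Rintegral_ge0.
apply: (@filterS _ _ (ae_filter_lebesgue R) _ _ _ (d_eq j)) => t H Pt M.
rewrite H // /partial -sumrB mulr_suml; apply: le_trans (ler_norm_sum _ _ _) _.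
apply: ler_sum => k _; rewrite -mulrBr normrM -[leRHS]mulrA ler_wpM2l //.
by have /andP[q0 q1] := q01 j k; exact: conv_pker_approx.
Qed.

Let pintegrable_partial j M : pintegrable (partial j M).
Proof.
apply: pintegrable_sum => k _; apply: pintegrableZ; apply: pintegrable_sum => m _.
by apply/pintegrableZ/pintegrable_continuous; exact: continuous_mode.
Qed.

(** Testing against frequency [i] keeps a single term of each inner series once [M] reaches [i], and
    the error decays geometrically. *)
Lemma conv_system_mode j (i : nat) s : (0 < i)%N ->
  mode i (d j) s = pi * \sum_(k < n | k != j) kap j k * q j k ^+ i * mode i (d k) s.
Proof.
move=> i0; have [B [Q [B0 Q01 H]]] := partial_approx j.
apply/eqP; rewrite -subr_eq0; apply/eqP.
apply: (@geometric_squeeze _ _ (B * (2 * pi)) Q i) => // M iM.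
have ip : pintegrable (partial j M) by exact: pintegrable_partial.
have -> : pi * \sum_(k < n | k != j) kap j k * q j k ^+ i * mode i (d k) s =
    pint (fun t => cos (i%:R * t - i%:R * s) * partial j M t).
  under [X in pint X]eq_fun => t.
    rewrite mulr_sumr; under eq_bigr => k _ do rewrite mulrCA mulr_sumr.
    over.
  have im k m : pintegrable (fun t => cos (i%:R * t - i%:R * s) *
    (q j k ^+ m * mode m (d k) t)).
    apply/pintegrable_cosM/pintegrableZ/pintegrable_continuous.
    exact: continuous_mode.
  rewrite pint_sum => [|k _]; last exact/pintegrableZ/pintegrable_sum.
  rewrite mulr_sumr; apply: eq_bigr => k _; rewrite pintZ; last exact: pintegrable_sum.
  rewrite pint_sum // (bigD1_seq i) ?mem_index_iota ?i0 ?ltnS ?iota_uniq //=.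
  have E m : pint (fun t => cos (i%:R * t - i%:R * s) * (q j k ^+ m * mode m (d k) t)) =
      q j k ^+ m * if i == m then pi * mode i (d k) s else 0.
    rewrite -pint_cos_mode // -pintZ.
      by apply: eq_pint => t _; rewrite mulrCA.
    by apply/pintegrable_cosM/pintegrable_continuous; exact: continuous_mode.
  rewrite big1 => [|m mi]; last by rewrite E eq_sym (negPf mi) mulr0.
  by rewrite addr0 E eqxx; ring.
rewrite /mode -pintB; [|exact: pintegrable_cosM..].
rewrite -[leRHS]mulrA [2 * pi * _]mulrC mulrA.
apply: pint_ae_bound; first by rewrite mulr_ge0 // exprn_ge0 //; case/andP: Q01.
  by apply: pintegrableB; exact: pintegrable_cosM.
apply: (@filterS _ _ (ae_filter_lebesgue R) _ _ _ H) => t Ht Pt.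
rewrite -mulrBr normrM; apply: le_trans (Ht Pt M).
by rewrite ler_piMl // cos_max.
Qed.

Lemma conv_system_eq0 : (forall j i s, (0 < i)%N -> mode i (d j) s = 0) ->
  forall j, {ae mu, forall t, period R t -> d j t = 0}.
Proof.
move=> mode0 j; have [B [Q [B0 Q01 H]]] := partial_approx j.
apply: (@filterS _ _ (ae_filter_lebesgue R) _ _ _ H) => t Ht Pt.
apply: (@geometric_squeeze _ _ B Q 0) => // M _.
have := Ht Pt M; rewrite /partial big1 ?subr0 // => k _.
by rewrite big_nat_cond big1 ?mulr0 // => m /andP[/andP[m0 _] _]; rewrite mode0 ?mulr0.
Qed.
End ConvolutionSystem.

(** * Layer potentials on circles *)

Section CircleGeometry.
Variable R : realType.
Implicit Types (a rho s t u : R) (f phi : plane R -> R).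

Lemma enorm_circ rho t : 0 <= rho -> enorm (circ rho t) = rho.
Proof.
move=> r0; rewrite /enorm /circ /= !exprMn -mulrDr cos2Dsin2 mulr1.
by rewrite sqrtr_sqr ger0_norm.
Qed.

Lemma normal_circ rho t : 0 < rho -> normal (circ rho t) = circ 1 t.
Proof.
move=> r0; rewrite /normal (enorm_circ _ (ltW r0)) /circ /= !mul1r.
by rewrite [rho * cos t]mulrC [rho * sin t]mulrC !mulfK ?gt_eqF.
Qed.

Lemma harmonic_circ n rho t : 0 < rho -> period R t ->
  Defs.harmonic n (circ rho t) = rho ^+ n * cos (n%:R * t).
Proof.
move=> r0; rewrite /period /= in_itv /= => /andP[t0 t2pi].
rewrite /Defs.harmonic (enorm_circ _ (ltW r0)); congr (_ * _).
rewrite /polar_angle (enorm_circ _ (ltW r0)) /circ /=.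
rewrite [rho * cos t]mulrC (mulfK (lt0r_neq0 r0)).
(* Cosine is even, so only [acos (cos t)] matters; it equals [2 * pi - t] when [t] exceeds [pi]. *)
suff E : cos (n%:R * acos (cos t)) = cos (n%:R * t).
  by case: ifP => _; rewrite ?mulrN ?cosN E.
have [tpi|pit] := leP t pi; first by rewrite cosK // in_itv /= t0.
have -> : cos t = cos (t - 2 * pi).
  by rewrite -[in LHS](subrK (2 * pi) t) mulr_natl cosD2pi.
rewrite cosKN; last by apply/andP; split; lra.
have -> : n%:R * - (t - 2 * pi) = - (n%:R * t) + (pi *+ 2) *+ n.
  by rewrite -[X in _ = _ + X]mulr_natl -[pi *+ 2]mulr_natl; ring.
by rewrite (periodicn (@cosD2pi R)) cosN.
Qed.

Lemma normal_derive_circ f rho t (d : R) : 0 < rho ->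
  is_derive rho 1 (fun s => f (circ s t) : R^o) d ->
  normal_derive f (circ rho t) = d.
Proof.
move=> r0 [_ <-]; rewrite /normal_derive normal_circ // /derive.
apply: congr1; apply: (congr1 (fun g : R -> R^o => g @ 0^')); apply/funext => h /=.
have -> : h%:A = h by rewrite /GRing.scale /= mulr1.
by rewrite /circ !mul1r !mulrDl.
Qed.

Lemma normal_derive_harmonic n rho t : 0 < rho -> period R t ->
  normal_derive (Defs.harmonic n) (circ rho t) =
  n%:R * rho ^+ n.-1 * cos (n%:R * t).
Proof.
move=> r0 Pt; apply: normal_derive_circ => //.
apply: (@near_eq_is_derive _ _ _ (horner (cos (n%:R * t) *: 'X^n))).
  apply: filterS (lt_nbhsr r0) => s s0.
  by rewrite harmonic_circ // hornerZ hornerXn mulrC.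
apply: is_derive_eq.
by rewrite derivZ derivXn hornerZ hornerMn hornerXn -[_ *+ n]mulr_natl; ring.
Qed.

(** Law of cosines: the squared distance between points of the circles of radii [rho] and [a] at
    angular difference [th]. *)
Definition sqdist rho a th : R := rho ^+ 2 - 2 * rho * a * cos th + a ^+ 2.

Lemma sqdist_ge rho a th : 0 <= rho -> 0 <= a ->
  (rho - a) ^+ 2 <= sqdist rho a th.
Proof.
move=> r0 a0; have := ler_piMr (mulr_ge0 r0 a0) (cos_le1 th).
by rewrite /sqdist !expr2; lra.
Qed.

Lemma sqdist_ge0 rho a th : 0 <= sqdist rho a th.
Proof.
have -> : sqdist rho a th = (rho - a * cos th) ^+ 2 + (a * sin th) ^+ 2.
  by rewrite /sqdist [(a * sin th) ^+ 2]exprMn sin2cos2; ring.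
by rewrite addr_ge0 // sqr_ge0.
Qed.

Lemma G_circ rho a t u :
  G (circ rho t - circ a u) = (4 * pi)^-1 * ln (sqdist rho a (t - u)).
Proof.
rewrite /G /enorm.
have -> : (circ rho t - circ a u).1 ^+ 2 + (circ rho t - circ a u).2 ^+ 2 =
    sqdist rho a (t - u).
  rewrite /sqdist cosB /=.
  transitivity (rho ^+ 2 * (cos t ^+ 2 + sin t ^+ 2) -
    2 * rho * a * (cos t * cos u + sin t * sin u) +
    a ^+ 2 * (cos u ^+ 2 + sin u ^+ 2)); first by ring.
  by rewrite !cos2Dsin2 !mulr1.
have D := sqdist_ge0 rho a (t - u).
have -> : ln (sqdist rho a (t - u)) = 2 * ln (Num.sqrt (sqdist rho a (t - u))).
  have [s0|s0] := ltP 0 (Num.sqrt (sqdist rho a (t - u))).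
    by rewrite -[in LHS](sqr_sqrtr D) lnXn // mulr_natl.
  (* At coinciding points both logarithms take the default value 0. *)
  by rewrite (ln0 s0) mulr0 ln0 // -sqrtr_eq0 eq_le s0 sqrtr_ge0.
rewrite mulrA; congr (_ * _).
by move: (@pi R) (lt0r_neq0 (pi_gt0 R)) => p p0; field.
Qed.

Definition radial_kernel rho a th : R := (rho - a * cos th) / sqdist rho a th.

Lemma is_derive_G rho a t u : 0 < sqdist rho a (t - u) ->
  is_derive rho 1 (fun s => G (circ s t - circ a u) : R^o)
    ((2 * pi)^-1 * radial_kernel rho a (t - u)).
Proof.
move=> D0; under eq_fun do rewrite G_circ.
have H := is_derive1_ln D0.
pose p : {poly R} := 'X^2 - (2 * a * cos (t - u)) *: 'X + (a ^+ 2)%:P.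
have pE s : p.[s] = sqdist s a (t - u).
  by rewrite /p /sqdist !hornerE; ring.
have K : is_derive rho (1 : R) (fun s => sqdist s a (t - u) : R^o)
    (2 * rho - 2 * a * cos (t - u)).
  under eq_fun do rewrite -pE.
  apply: is_derive_eq; rewrite /p derivD derivB derivZ derivXn derivX derivC.
  by rewrite !hornerE; ring.
have Z := is_deriveZ (4 * pi)^-1
  (is_derive1_comp (g := fun s => sqdist s a (t - u)) H K).
apply: (is_derive_eq Z); rewrite /GRing.scale /= /radial_kernel.
have -> : 2 * rho - 2 * a * cos (t - u) = 2 * (rho - a * cos (t - u)) by ring.
move: (@pi R) (lt0r_neq0 (pi_gt0 R)) => pi0 pi0_neq0.
by field; rewrite pi0_neq0 gt_eqF.
Qed.

Lemma radial_kernel_outer rho a th : 0 < a -> a < rho ->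
  radial_kernel rho a th = rho^-1 * pker (a / rho) th.
Proof.
move=> a0 ar; have r0 := lt_trans a0 ar.
have q01 : 0 <= a / rho < 1 by rewrite divr_ge0 ?ltW //= ltr_pdivrMr // mul1r.
have D := pker_den_gt0 th q01.
rewrite /radial_kernel /pker.
have -> : sqdist rho a th =
    rho ^+ 2 * (1 - 2 * (a / rho) * cos th + (a / rho) ^+ 2).
  by rewrite /sqdist; field; rewrite gt_eqF.
move: (_ + _ ^+ 2) D => d d0.
by field; rewrite !gt_eqF.
Qed.

Lemma radial_kernel_inner rho a th : 0 < rho -> rho < a ->
  radial_kernel rho a th = rho^-1 * (1 - pker (rho / a) th).
Proof.
move=> r0 ra; have a0 := lt_trans r0 ra.
have q01 : 0 <= rho / a < 1 by rewrite divr_ge0 ?ltW //= ltr_pdivrMr // mul1r.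
have D := pker_den_gt0 th q01.
rewrite /radial_kernel /pker.
have SE : sqdist rho a th =
    a ^+ 2 * (1 - 2 * (rho / a) * cos th + (rho / a) ^+ 2).
  by rewrite /sqdist; field; rewrite gt_eqF.
have S0 : sqdist rho a th != 0 by rewrite SE mulf_neq0 ?gt_eqF // exprn_gt0.
have -> : 1 - 2 * (rho / a) * cos th + (rho / a) ^+ 2 = sqdist rho a th / a ^+ 2.
  by rewrite SE [a ^+ 2 * _]mulrC mulfK // gt_eqF // exprn_gt0.
rewrite invf_div; apply: (mulfI S0); rewrite mulrCA divff // mulr1.
rewrite mulrCA mulrBr mulr1.
have -> : sqdist rho a th * ((1 - rho / a * cos th) * (a ^+ 2 / sqdist rho a th)) =
  (1 - rho / a * cos th) * a ^+ 2 by field; rewrite S0 (gt_eqF a0).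
by rewrite /sqdist; field; rewrite !gt_eqF.
Qed.

(* On densities of mean zero the radial kernel acts as [coupling rho a] times the
   convolution with [pker (ratio rho a)]: for [rho < a] the constant term of
   [1 - pker] drops out. *)
Definition coupling rho a : R := if a < rho then rho^-1 else - rho^-1.
Definition ratio rho a : R := if a < rho then a / rho else rho / a.

Lemma ratio01 rho a : 0 < rho -> 0 < a -> rho != a -> 0 <= ratio rho a < 1.
Proof.
move=> r0 a0 ra; rewrite /ratio; have [ar|] := ltP a rho.
  by rewrite divr_ge0 ?ltW //= ltr_pdivrMr // mul1r.
rewrite le_eqVlt (negPf ra) /= => {}ra.
by rewrite divr_ge0 ?ltW //= ltr_pdivrMr // mul1r.
Qed.

Lemma pint_radial_kernel rho a t (g : R -> R) : 0 < rho -> 0 < a -> rho != a ->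
  pintegrable g -> pint g = 0 ->
  pint (fun u => radial_kernel rho a (t - u) * g u) =
  coupling rho a * conv_pker (ratio rho a) g t.
Proof.
move=> r0 a0 ra ig g0; have := ratio01 r0 a0 ra.
rewrite /coupling /ratio; have [ar|] := ltP a rho; first move=> q01.
  rewrite /conv_pker -pintZ; last exact: pintegrable_pkerM.
  by apply: eq_pint => u _; rewrite radial_kernel_outer // mulrA.
rewrite le_eqVlt (negPf ra) /= => {}ra q01.
transitivity (pint (fun u => rho^-1 * (g u - pker (rho / a) (t - u) * g u))).
  by apply: eq_pint => u _; rewrite radial_kernel_inner // -mulrA mulrBl mul1r.
rewrite pintZ; last by apply: pintegrableB => //; exact: pintegrable_pkerM.
rewrite pintB //; last exact: pintegrable_pkerM.
by rewrite g0 sub0r mulrN mulNr.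
Qed.
End CircleGeometry.

(** * Normal derivatives of layer potentials *)

Section LayerPotentials.
Variable R : realType.
Implicit Types (a rho s t u : R) (f phi : plane R -> R).
Local Notation mu := (@lebesgue_measure R).

Lemma continuous_sqdist rho a t : continuous (fun u : R => sqdist rho a (t - u)).
Proof.
move=> u; have cc : {for u, continuous (fun u : R => cos (t - u))}.
  apply: continuous_comp; last exact: continuous_cos.
  by apply: continuousB; [exact: cst_continuous|exact: id].
apply: cvgD; last exact: cvg_cst.
by apply: cvgB; [exact: cvg_cst|apply: cvgMr; exact: cc].
Qed.

Lemma sqdist_gt0 rho a th : 0 <= rho -> 0 <= a -> rho != a -> 0 < sqdist rho a th.
Proof.
move=> r0 a0 ra; apply: lt_le_trans (sqdist_ge th r0 a0).
by rewrite exprn_even_gt0 //= subr_eq0.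
Qed.

Lemma pintegrable_GM rho a t (g : R -> R) : 0 <= rho -> 0 <= a -> rho != a ->
  pintegrable g -> pintegrable (fun u => G (circ rho t - circ a u) * g u).
Proof.
move=> r0 a0 ra ig; apply: pintegrableM ig.
  apply: measurable_continuous => u.
  rewrite (_ : (fun u => _) = (fun u => (4 * pi)^-1 * ln (sqdist rho a (t - u)))).
    apply: cvgMr; apply: continuous_comp; first exact: continuous_sqdist.
    exact/continuous_ln/sqdist_gt0.
  by apply/funext => v; exact: G_circ.
exists (`|(4 * pi)^-1| * (`|ln ((rho - a) ^+ 2)| + `|ln ((rho + a) ^+ 2)|)) => u.
rewrite G_circ normrM ler_wpM2l //.
have D0 := sqdist_gt0 (t - u) r0 a0 ra.
have D1 : ln ((rho - a) ^+ 2) <= ln (sqdist rho a (t - u)).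
  rewrite ler_ln ?posrE ?sqdist_ge //.
  by rewrite exprn_even_gt0 //= subr_eq0.
have S : sqdist rho a (t - u) <= (rho + a) ^+ 2.
  have := ler_wpM2l (mulr_ge0 r0 a0) (cos_geN1 (t - u)).
  by rewrite /sqdist !expr2; lra.
have D2 : ln (sqdist rho a (t - u)) <= ln ((rho + a) ^+ 2).
  by rewrite ler_ln ?posrE //; exact: lt_le_trans S.
rewrite ler_norml; apply/andP; split.
  have := ler_normr (ln ((rho - a) ^+ 2)) (- ln ((rho - a) ^+ 2)).
  have := normr_ge0 (ln ((rho + a) ^+ 2)).
  have := ler_norm (- ln ((rho - a) ^+ 2)); rewrite normrN; lra.
have := normr_ge0 (ln ((rho - a) ^+ 2)); have := ler_norm (ln ((rho + a) ^+ 2)); lra.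
Qed.

Lemma radial_kernel_le rho a th (delta : R) : 0 < rho -> 0 < a -> 0 < delta ->
  delta <= `|rho - a| -> `|radial_kernel rho a th| <= (rho + a) / delta ^+ 2.
Proof.
move=> r0 a0 d0 dra; have D : delta ^+ 2 <= sqdist rho a th.
  apply: le_trans (sqdist_ge _ (ltW r0) (ltW a0)).
  by rewrite -[leRHS]real_normK ?num_real // lerXn2r // nnegrE ltW.
have D0 : 0 < sqdist rho a th by apply: lt_le_trans D; rewrite exprn_gt0.
rewrite normrM normfV (gtr0_norm D0); apply: ler_pM => //.
- by rewrite invr_ge0 ltW.
- apply: le_trans (ler_normB _ _) _; rewrite (gtr0_norm r0) lerD2l normrM.
  by rewrite (gtr0_norm a0) ler_piMr ?cos_max // ltW.
- by rewrite lef_pV2 ?posrE ?exprn_gt0.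
Qed.

Lemma pintegrable_radial_kernel rho a t (g : R -> R) :
  0 < rho -> 0 < a -> rho != a -> pintegrable g ->
  pintegrable (fun u => radial_kernel rho a (t - u) * g u).
Proof.
move=> r0 a0 ra ig; apply: pintegrableM ig.
  apply: measurable_continuous => u; apply: cvgM.
    apply: cvgB; first exact: cvg_cst.
    apply: cvgMr; apply: continuous_comp; last exact: continuous_cos.
    by apply: continuousB; [exact: cst_continuous|exact: id].
  apply: cvgV; last exact: continuous_sqdist.
  by rewrite gt_eqF // sqdist_gt0 // ltW.
exists ((rho + a) / `|rho - a| ^+ 2) => u; apply: radial_kernel_le => //.
by rewrite normr_gt0 subr_eq0.
Qed.

Lemma normal_derive_single_layer rho a t phi : 0 < rho -> 0 < a -> rho != a ->
  pintegrable (fun u => phi (circ a u)) ->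
  normal_derive (single_layer a phi) (circ rho t) =
  (2 * pi)^-1 * a * pint (fun u => radial_kernel rho a (t - u) * phi (circ a u)).
Proof.
move=> r0 a0 ra ig; apply: normal_derive_circ => //.
pose f s u := G (circ s t - circ a u) * phi (circ a u) * a.
pose df s u := (2 * pi)^-1 * radial_kernel s a (t - u) * phi (circ a u) * a.
(* On this neighbourhood of [rho] the radius stays positive and at distance at least [delta] from
   [a], which gives a dominating function. *)
pose delta := Num.min rho `|rho - a| / 2.
have d0 : 0 < delta by rewrite divr_gt0 // lt_min r0 normr_gt0 subr_eq0.
have dr : delta * 2 <= rho by rewrite divfK // ge_min lexx.
have dra : delta * 2 <= `|rho - a| by rewrite divfK // ge_min lexx orbT.
have Irho : `]rho - delta, rho + delta[%classic rho.
  by rewrite /= in_itv /= ltrDl ltrBlDr ltrDl d0.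
have II s : `]rho - delta, rho + delta[%classic s ->
    [/\ 0 < s, s <= 2 * rho, s != a & delta <= `|s - a|].
  rewrite /= in_itv /= => /andP[s1 s2].
  have sa : delta <= `|s - a|.
    have : `|rho - a| <= `|rho - s| + `|s - a|.
      by apply: le_trans (ler_normD _ _); rewrite addrA subrK.
    have : `|rho - s| <= delta by rewrite ler_norml; lra.
    lra.
  split; [lra|lra| |by []].
  by apply: contraTneq sa => ->; rewrite subrr normr0 -ltNge.
have isf s u : `]rho - delta, rho + delta[%classic s ->
    is_derive s (1 : R) (f^~ u : R -> R^o) (df s u).
  move=> /II[s0 _ sna _].
  have Z := is_derive_G (sqdist_gt0 (t - u) (ltW s0) (ltW a0) sna).
  have Z' := is_deriveZ (phi (circ a u) * a) Z.
  rewrite (_ : f^~ u = (phi (circ a u) * a) \*: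
      (fun s => G (circ s t - circ a u) : R^o)).
    by apply: (is_derive_eq Z'); rewrite /df /GRing.scale /=; ring.
  by apply/funext => x; rewrite /f /= /GRing.scale /=; ring.
have intf s : `]rho - delta, rho + delta[%classic s ->
    mu.-integrable (period R) (EFin \o f s).
  move=> /II[s0 _ sna _].
  rewrite (_ : f s = fun u => a * (G (circ s t - circ a u) * phi (circ a u))).
    by apply: (@pintegrableZ R); apply: pintegrable_GM => //; exact: ltW.
  by apply/funext => u; rewrite /f mulrC.
have derf s u : `]rho - delta, rho + delta[%classic s -> period R u ->
    derivable (f^~ u) s 1.
  by move=> Is _; case: (isf s u Is).
have f'E s u : `]rho - delta, rho + delta[%classic s -> partial1of2 f s u = df s u.
  by move=> Is; rewrite partial1of2E; case: (isf s u Is).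
pose C := (2 * pi)^-1 * ((2 * rho + a) / delta ^+ 2) * a.
pose B u := C * `|phi (circ a u)|.
have p0 : 0 <= (2 * pi)^-1 :> R by rewrite invr_ge0 ltW // twopi_gt0.
have C0 : 0 <= C.
  by rewrite mulr_ge0 ?(ltW a0) // mulr_ge0 // divr_ge0 ?sqr_ge0 //; lra.
have B0 u : 0 <= B u by rewrite mulr_ge0.
have intB : mu.-integrable (period R) (EFin \o B).
  by apply: (@pintegrableZ R); exact: integrable_norm.
have Bub s u : `]rho - delta, rho + delta[%classic s -> period R u ->
    `|partial1of2 f s u| <= B u.
  move=> Is _; rewrite f'E // /df /B /C; have [s0 s2 sna dsa] := II _ Is.
  have rk := radial_kernel_le (t - u) s0 a0 d0 dsa.
  move: (radial_kernel _ _ _) rk => k rk.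
  rewrite mulrAC normrM ler_wpM2r // !normrM (gtr0_norm a0) ler_wpM2r ?(ltW a0) //.
  rewrite ger0_norm // ler_wpM2l //.
  apply: le_trans rk _.
  by rewrite ler_wpM2r ?invr_ge0 ?sqr_ge0 // lerD2r.
have D := derivable_under_integral (@measurable_period R) Irho intf derf B0 intB Bub.
have V := differentiation_under_integral
  (@measurable_period R) Irho intf derf B0 intB Bub.
apply: DeriveDef; first exact: D.
rewrite -derive1E [LHS]V -pintZ.
  by apply: eq_pint => u _; rewrite f'E // /df; ring.
exact: pintegrable_radial_kernel.
Qed.

(** The endpoints 0 and [2 * pi] are excluded since they give the same point of the circle. *)
Lemma cos_neq1 t u : period R t -> period R u -> u \notin [:: t; 0; 2 * pi] ->
  cos (t - u) < 1.
Proof.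
rewrite /period /= !in_itv /= => /andP[t0 t2] /andP[u0 u2].
rewrite !inE !negb_or => /and3P[ut un0 un2].
have E x : 0 < x -> x < 2 * pi -> cos x < 1 :> R.
  move=> x0 x2; have := sin_gt0_pi (x := x / 2); rewrite divr_gt0 //= ltr_pdivrMr //.
  rewrite mulrC x2 => /(_ isT) s0.
  rewrite -[x in cos x](@divfK _ 2) // mulrC mulr_natl cos_mulr2n cos2sin2.
  by have := mulr_gt0 s0 s0; rewrite -expr2; lra.
have u0' : 0 < u by rewrite lt_neqAle eq_sym un0.
have u2' : u < 2 * pi by rewrite lt_neqAle un2.
have [tu|ut'|tu] := ltgtP t u.
- by rewrite -cosN opprB E; lra.
- by rewrite E; lra.
- by rewrite tu eqxx in ut.
Qed.

(** On its own circle the radial kernel is the constant [1 / (2 rho)] off the pole, so the operator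
    kills densities of mean zero. *)
Lemma NP_adjoint_circ rho t phi : 0 < rho -> period R t ->
  pintegrable (fun u => phi (circ rho u)) ->
  NP_adjoint rho phi (circ rho t) = (4 * pi)^-1 * pint (fun u => phi (circ rho u)).
Proof.
move=> r0 Pt ig; rewrite -pintZ //.
apply: (@pint_finite _ [:: t; 0; 2 * pi]); first exact: pintegrableZ.
move=> u Pu ut; have c1 := cos_neq1 Pt Pu ut.
have S : sqdist rho rho (t - u) = 2 * rho ^+ 2 * (1 - cos (t - u)).
  by rewrite /sqdist; ring.
have S0 : 0 < sqdist rho rho (t - u).
  by rewrite S !mulr_gt0 ?exprn_gt0 // subr_gt0.
rewrite (normal_derive_circ r0 (is_derive_G S0)) /radial_kernel S.
have := lt0r_neq0 (pi_gt0 R); move: (@pi R) => p p0.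
have c0 : 1 - cos (t - u) != 0 by rewrite gt_eqF // subr_gt0.
move: (cos _) c0 => c c0.
have -> : rho - rho * c = rho * (1 - c) by ring.
by field; rewrite p0 c0 gt_eqF.
Qed.

Lemma L2_pintegrable rho phi : 0 < rho -> L2_circle rho phi ->
  pintegrable (fun u => phi (circ rho u)).
Proof.
move=> r0 [mphi isq].
(* Square integrability suffices on a bounded period, by [|x| <= 1 + x^2]. *)
have i1 : pintegrable (fun u => 1 + rho^-1 * (phi (circ rho u) ^+ 2 * rho)).
  apply: pintegrableD; last exact: pintegrableZ.
  by apply: pintegrable_continuous; exact: cst_continuous.
apply: le_integrable i1; first exact: measurable_period.
  exact/measurable_EFinP.
move=> u _ /=; rewrite lee_fin.
have -> : rho^-1 * (phi (circ rho u) ^+ 2 * rho) = phi (circ rho u) ^+ 2.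
  by field; rewrite gt_eqF.
move: (phi _) => x; have x2 := sqr_ge0 x.
rewrite [leRHS]ger0_norm ?addr_ge0 // -(real_normK (num_real x)).
have := sqr_ge0 (`|x| - 1); rewrite !expr2.
have := normr_ge0 x; nra.
Qed.
End LayerPotentials.

(** * The transmission system *)

Section ConcentricDisks.
Variables (R : realType) (N : nat) (r eta : 'I_N.+1 -> R).
Local Notation mu := (@lebesgue_measure R).
Hypothesis r_gt0 : forall k, 0 < r k.
Hypothesis r_decr : forall j k : 'I_N.+1, (j < k)%N -> r k < r j.
Hypothesis eta_le1 : forall k, `|eta k| <= 1.

Let r_neq (j k : 'I_N.+1) : k != j -> r j != r k.
Proof.
rewrite -val_eqE /= neq_ltn => /orP[] /r_decr H; first by rewrite lt_eqF.
by rewrite gt_eqF.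
Qed.

(* The factor [r_j ^ (i-1)] turns the system for the [i]-th Fourier coefficients
   into [layer_system]. *)
Lemma coupling_sum (i : nat) (x : nat -> R) (j : 'I_N.+1) : (0 < i)%N ->
  \sum_(k < N.+1 | k != j) r k * coupling (r j) (r k) * ratio (r j) (r k) ^+ i *
    (x k * r k ^+ i.-1) =
  r j ^+ i.-1 * (- \sum_(0 <= k < j) x k +
    (\sum_(j.+1 <= k < N.+1) r (inord k) ^+ (2 * i) * x k) / r j ^+ (2 * i)).
Proof.
case: i => // i _; rewrite [i.+1.-1]/=.
rewrite big_mkord (big_ord_widen N.+1) ?(ltnW (ltn_ord j)) // big_geq_mkord.
rewrite (bigID (fun k : 'I_N.+1 => (k < j)%N)) /= mulrDr mulrN -mulNr.
congr (_ + _).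
  rewrite mulr_sumr; apply: eq_big => [k|k /andP[_ kj]].
    by case: ltngtP => [||/val_inj->];
      rewrite ?andbT ?andbF ?eqxx // -val_eqE neq_ltn => ->.
  have rr := r_decr kj; rewrite /coupling /ratio ltNge (ltW rr) /=.
  have := r_gt0 j; have := r_gt0 k; move: (r j) (r k) => a b b0 a0.
  rewrite expr_div_n !exprS.
  have := lt0r_neq0 (exprn_gt0 i a0); have := lt0r_neq0 (exprn_gt0 i b0).
  move: (a ^+ i) (b ^+ i) => A B B0 A0.
  by field; rewrite ?A0 ?B0 ?(gt_eqF a0) ?(gt_eqF b0).
rewrite mulr_suml mulr_sumr; apply: eq_big => [k|k].
  by rewrite -leqNgt; case: ltngtP => [||/val_inj->];
    rewrite ?andbT ?andbF ?eqxx //= -val_eqE neq_ltn => ->; rewrite ?orbT.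
rewrite -leqNgt => /andP[kj jk]; rewrite inord_val.
have rr : r k < r j by apply: r_decr; rewrite ltn_neqAle jk andbT eq_sym.
rewrite /coupling /ratio rr.
have := r_gt0 j; have := r_gt0 k; move: (r j) (r k) => a b b0 a0.
rewrite mul2n -addnn !exprD expr_div_n !exprS.
have := lt0r_neq0 (exprn_gt0 i a0); have := lt0r_neq0 (exprn_gt0 i b0).
move: (a ^+ i) (b ^+ i) => A B B0 A0.
by field; rewrite ?A0 ?B0 ?(gt_eqF a0) ?(gt_eqF b0).
Qed.
(** Beyond the last circle any value in []0, 1[] would do; [1/2] makes the bounds hold for all
    [j]. *)
Definition layer_ratio (i j : nat) : R :=
  if (j < N)%N then (r (inord j.+1) / r (inord j)) ^+ (2 * i) else 2^-1.

Let w (i j : nat) : R := r (inord j) ^+ (2 * i).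

Lemma layer_ratio01 i j : (0 < i)%N -> 0 < layer_ratio i j < 1.
Proof.
move=> i0; rewrite /layer_ratio; case: ifP => jN; last first.
  by rewrite invr_gt0 ltr0n /= invf_lt1 // ltr1n.
rewrite exprn_gt0 ?divr_gt0 //= exprn_ilt1 ?muln_eq0 ?negb_or -?lt0n //.
- by rewrite divr_ge0 // ltW.
- rewrite ltr_pdivrMr // mul1r r_decr // !inordK //.
  exact: leqW.
Qed.

Let w_gt0 i j : 0 < w i j.
Proof. by rewrite exprn_gt0. Qed.

Let w_ratio i j : (j < N)%N -> w i j.+1 = layer_ratio i j * w i j.
Proof.
move=> jN; rewrite /layer_ratio jN /w expr_div_n divfK // gt_eqF //.
exact: exprn_gt0.
Qed.

Let kap j k : R := pi^-1 * (eta j * (r k * coupling (r j) (r k))).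
(** The diagonal is left out of all sums; 0 replaces the value 1 that [ratio] has there, so that
    [q01] holds for all pairs. *)
Let q (j k : 'I_N.+1) : R := if k == j then 0 else ratio (r j) (r k).

Let q01 j k : 0 <= q j k < 1.
Proof.
rewrite /q; case: eqVneq => [_|kj]; first by rewrite lexx ltr01.
by apply: ratio01 => //; exact: r_neq.
Qed.

Lemma L20_mean rho (f : plane R -> R) : 0 < rho -> L20_circle rho f ->
  pintegrable (fun u => f (circ rho u)) /\ pint (fun u => f (circ rho u)) = 0.
Proof.
move=> r0 [L2f m0]; have ig := L2_pintegrable r0 L2f; split => //; move: m0.
have -> : circle_int rho f = rho * pint (fun u => f (circ rho u)).
  by rewrite -pintZ //; apply: eq_pint => u _; rewrite mulrC.
by move/eqP; rewrite mulf_eq0 gt_eqF //= => /eqP.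
Qed.

Lemma density_equationE (phi : 'I_N.+1 -> plane R -> R) n j t :
  (forall k, L20_circle (r k) (phi k)) -> period R t ->
  (phi j (circ (r j) t) - 2 * eta j * NP_adjoint (r j) (phi j) (circ (r j) t)
     - 2 * eta j * \sum_(k < N.+1 | k != j)
         normal_derive (single_layer (r k) (phi k)) (circ (r j) t)
     = 2 * eta j * normal_derive (Defs.harmonic n) (circ (r j) t)) <->
  phi j (circ (r j) t) =
    \sum_(k < N.+1 | k != j)
      kap j k * conv_pker (q j k) (fun u => phi k (circ (r k) u)) t +
    2 * eta j * (n%:R * r j ^+ n.-1 * cos (n%:R * t)).
Proof.
move=> Lphi Pt; rewrite normal_derive_harmonic //.
have [ij mj] := L20_mean (r_gt0 j) (Lphi j).
rewrite NP_adjoint_circ // mj !mulr0 subr0.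
have -> : 2 * eta j * \sum_(k < N.+1 | k != j)
    normal_derive (single_layer (r k) (phi k)) (circ (r j) t) =
    \sum_(k < N.+1 | k != j)
      kap j k * conv_pker (q j k) (fun u => phi k (circ (r k) u)) t.
  rewrite mulr_sumr; apply: eq_bigr => k kj.
  have [ik mk] := L20_mean (r_gt0 k) (Lphi k).
  rewrite normal_derive_single_layer // ?r_neq // pint_radial_kernel // ?r_neq //.
  rewrite /kap /q (negPf kj).
  move: (@pi R) (lt0r_neq0 (pi_gt0 R)) => p p0; field; exact: p0.
split=> [/eqP|->]; first by rewrite subr_eq addrC => /eqP.
by rewrite addrAC subrr add0r.
Qed.

(** The difference of two solutions solves the homogeneous convolution system; its rescaled modes
    solve [layer_system] with [c = 0] and vanish. *)
Lemma density_unique n phi psi :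
  density_solution r eta (Defs.harmonic n) phi ->
  density_solution r eta (Defs.harmonic n) psi ->
  forall j, ae_circle (r j) (fun x => psi j x = phi j x).
Proof.
move=> [Lphi ephi] [Lpsi epsi].
pose d j t := psi j (circ (r j) t) - phi j (circ (r j) t).
have Iphi k := (L20_mean (r_gt0 k) (Lphi k)).1.
have Ipsi k := (L20_mean (r_gt0 k) (Lpsi k)).1.
have dI j : pintegrable (d j) by exact: pintegrableB.
have d0 j : pint (d j) = 0.
  rewrite /d pintB // (L20_mean (r_gt0 j) (Lphi j)).2.
  by rewrite (L20_mean (r_gt0 j) (Lpsi j)).2 subrr.
have deq j : {ae mu, forall t, period R t ->
    d j t = \sum_(k < N.+1 | k != j) kap j k * conv_pker (q j k) (d k) t}.
  apply: (@filterS2 _ _ (ae_filter_lebesgue R) _ _ _ _ (epsi j) (ephi j)).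
  move=> t e1 e2 Pt; rewrite /d.
  rewrite ((density_equationE _ _ Lpsi Pt).1 (e1 Pt)).
  rewrite ((density_equationE _ _ Lphi Pt).1 (e2 Pt)).
  rewrite opprD addrACA subrr addr0 -sumrB; apply: eq_bigr => k _.
  rewrite -mulrBr; congr (_ * _); rewrite /conv_pker -pintB;
    [|exact: pintegrable_pkerM..].
  by apply: eq_pint => u _; rewrite mulrBr.
have mode0 j i s : (0 < i)%N -> mode i (d j) s = 0.
  move=> i0; pose x (k : nat) := mode i (d (inord k)) s / r (inord k) ^+ i.-1.
  have xE (k : 'I_N.+1) : mode i (d k) s = x k * r k ^+ i.-1.
    by rewrite /x inord_val divfK // gt_eqF // exprn_gt0.
  suff x0 : x j = 0 by rewrite xE x0 mul0r.
  apply: (@layer_system0 R (layer_ratio i) _ _ (fun k => eta (inord k)) (w i) N) => //.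
  - by move=> k; case/andP: (layer_ratio01 k i0).
  - by move=> k; case/andP: (layer_ratio01 k i0).
  - exact: w_ratio.
  - move=> k kN; pose K := Ordinal (kN : (k < N.+1)%N).
    have KE : inord k = K by apply: val_inj; rewrite /= inordK.
    have := conv_system_mode q01 dI d0 deq K s i0.
    rewrite xE KE sub0r => H.
    have rK : r K ^+ i.-1 != 0 by rewrite gt_eqF // exprn_gt0.
    apply: (mulIf rK); rewrite [LHS]H.
    have := coupling_sum x K i0; rewrite /w KE /= => C.
    rewrite -[RHS]mulrA [X in _ = _ * X]mulrC -C mulr_sumr mulr_sumr.
    apply: eq_bigr => h hK.
    rewrite xE /kap /q (negPf hK).
    move: (@pi R) (lt0r_neq0 (pi_gt0 R)) => p p0; field; exact: p0.
  - by rewrite -ltnS.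
move=> j; have := conv_system_eq0 q01 dI d0 deq mode0 j.
apply: (@filterS _ _ (ae_filter_lebesgue R)) => t H Pt.
by apply/eqP; rewrite -subr_eq0; apply/eqP; exact: H.
Qed.
Lemma GPT_vanish n : (0 < n)%N ->
  refl (layer_ratio n) (fun k => eta (inord k)) N.+1 0 = 0 -> is_GPT r eta n 0.
Proof.
move=> n0 t0.
(* The amplitude [2 * n] is twice the coefficient of the normal derivative of [H], without the
   factor [r_j ^ (n-1)]. *)
have [x sys out0] := @layer_system_solvable R (layer_ratio n)
  (fun k => proj1 (andP (layer_ratio01 k n0)))
  (fun k => proj2 (andP (layer_ratio01 k n0)))
  (fun k => eta (inord k)) (w n) N (fun k => eta_le1 _) (w_gt0 n) (@w_ratio n)
  (2 * n%:R).
rewrite t0 mulr0 mul0r in out0.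
pose y (k : 'I_N.+1) := x k * r k ^+ n.-1.
(* A multiple of the harmonic itself, restricting to [x_k r_k ^ (n-1) cos (n t)] on circle [k]. *)
pose phi (k : 'I_N.+1) (p : plane R) := x k / r k * Defs.harmonic n p.
have rn k : r k ^+ n = r k * r k ^+ n.-1 by rewrite -exprS prednK.
have phiE k u : period R u -> phi k (circ (r k) u) = y k * cos (n%:R * u - 0).
  move=> Pu; rewrite /phi harmonic_circ // /y subr0 rn.
  by field; rewrite gt_eqF.
have ccos c : continuous (fun u : R => c * cos (n%:R * u - 0)).
  by move=> u; apply: cvgMr; exact: continuous_cosl.
have Lphi k : L20_circle (r k) (phi k).
  split; last first.
    rewrite /circle_int -[LHS]/(pint _).
    transitivity (pint (fun u => r k * y k * cos (n%:R * u - 0))).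
      by apply: eq_pint => u Pu; rewrite phiE //; ring.
    rewrite pintZ ?pint_cos ?gtn_eqF ?mulr0 //.
    by apply: pintegrable_continuous; exact: continuous_cosl.
  split.
    apply: eq_measurable_fun (measurable_continuous (ccos (y k))).
    by move=> u; rewrite inE => Pu; rewrite phiE.
  have : pintegrable (fun u => r k *
      ((y k * cos (n%:R * u - 0)) * (y k * cos (n%:R * u - 0)))).
    apply: pintegrableZ; apply: pintegrable_continuous => u.
    by apply: cvgM; exact: ccos.
  apply: eq_integrable; first exact: measurable_period.
  by move=> u; rewrite inE => Pu /=; rewrite phiE // expr2 mulrC.
have solphi : density_solution r eta (Defs.harmonic n) phi.
  split => // j; apply: aeW => t Pt; apply/density_equationE => //.
  rewrite phiE //.
  have -> : \sum_(k < N.+1 | k != j) kap j k *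
      conv_pker (q j k) (fun u => phi k (circ (r k) u)) t =
      eta j * (r j ^+ n.-1 * (- \sum_(0 <= k < j) x k +
        (\sum_(j.+1 <= k < N.+1) w n k * x k) / w n j)) * cos (n%:R * t - 0).
    rewrite /w inord_val -coupling_sum // mulr_sumr mulr_suml.
    apply: eq_bigr => k kj.
    have -> : conv_pker (q j k) (fun u => phi k (circ (r k) u)) t =
        y k * conv_pker (q j k) (fun u => cos (n%:R * u - 0)) t.
      rewrite /conv_pker -pintZ.
        by apply: eq_pint => u Pu; rewrite phiE //; ring.
      apply: pintegrable_pkerM => //.
      by apply: pintegrable_continuous; exact: continuous_cosl.
    rewrite conv_pker_cos // /kap /q (negPf kj) /y.
    move: (@pi R) (lt0r_neq0 (pi_gt0 R)) => p p0; field; exact: p0.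
  have jN : (j <= N)%N by rewrite -ltnS.
  rewrite /y [in LHS](sys j jN) inord_val subr0; ring.
exists phi; split; first by split => // psi; exact: density_unique.
(* The moment is [pi] times the total outgoing amplitude, which is 0 by [out0]. *)
symmetry; transitivity (pi * \sum_(0 <= k < N.+1) w n k * x k); last first.
  by rewrite out0 mulr0.
rewrite big_mkord mulr_sumr; apply: eq_bigr => k _.
rewrite /circle_int -[LHS]/(pint _).
transitivity (pint (fun u => r k ^+ n * y k * r k *
    (cos (n%:R * u - 0) * cos (n%:R * u - 0)))).
  by apply: eq_pint => u Pu; rewrite phiE // harmonic_circ // subr0; ring.
rewrite pintZ; last first.
  by apply: pintegrable_cosM; apply: pintegrable_continuous; exact: continuous_cosl.
rewrite pint_cos_cos // eqxx subrr cos0 /w inord_val /y mul2n -addnn exprD rn; ring.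
Qed.
End ConcentricDisks.

(* The implication [etaN1 != 0 -> eta' != 0] is deliberate: for etaN1 = 0 the
   vanishing may force eta' = 0.  For N = 1 one has M_1 = 2 pi eta_1 r_1^2. *)
Theorem theorem5p5 (R : realType) (N : nat) (hN : (1 <= N)%N)
    (r : 'I_N.+1 -> R)
    (r_gt0 : forall k, 0 < r k)
    (r_decr : forall j k : 'I_N.+1, (j < k)%N -> r k < r j)
    (etaN1 : R) (hetaN1 : -1 <= etaN1 <= 1) :
  exists eta' : 'rV[R]_N,
    (etaN1 != 0 -> eta' != 0) /\
    (forall n : 'I_N, -1 <= eta' 0 n <= 1) /\
    is_GPT_vector r (append_contrast eta' etaN1) 0.
Proof.
have e1 : `|etaN1| <= 1 by rewrite ler_norml.
(* The ordinal [i] indexes the mode [i + 1]. *)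
have q01 (i : 'I_N) j : 0 < layer_ratio r i.+1 j < 1 by exact: layer_ratio01.
have [x [cx x0 tx]] := exists_contrasts hN q01 e1.
exists x; split; [exact: x0|split] => [n|i]; first by rewrite -ler_norml.
rewrite mxE; apply: GPT_vanish => //.
by move=> k; exact: append_contrast_le1.
Qed.
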